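(* Let $G$ be a bipartite cubic plane graph with its natural proper $3$-face-coloring with color classes $\mathcal{C}_1,\mathcal{C}_2,\mathcal{C}_3$. Suppose that $\mathcal{C}_1$ and $\mathcal{C}_2$ consist of hexagons only, and that the graph obtained from $G$ by contracting each face in $\mathcal{C}_3$ to a single vertex is $4$-connected. Then $G$ is hamiltonian.
   Context: In a bipartite cubic plane graph the faces admit a proper $3$-coloring (adjacent faces receive distinct colors); each color class is a facial $2$-factor. *)

(* Defs.v *)
(* Plane graphs are represented combinatorially by
   rotation systems (combinatorial maps) of genus 0. *)
From mathcomp Require Import all_boot fingroup perm.
Set Implicit Arguments. Unset Strict Implicit. Unset Printing Implicit Defensive.

Section Maps.
Variable D : finType.
(* [n] : rotation of darts around their vertex; [e] : edge involution. *)
Variables (n e : {perm D}).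

Definition face_perm (x : D) : D := n (e x).

Definition vertex_of (x : D) : {set D} := [set y | fconnect n x y].
Definition face_of (x : D) : {set D} := [set y | fconnect face_perm x y].
Definition vertices : {set {set D}} := [set vertex_of x | x in D].
Definition faces : {set {set D}} := [set face_of x | x in D].

(* A connected, simple, cubic plane graph: e is a fixed-point-free
   involution, every vertex has degree 3, the map is connected,
   there are no parallel edges, and Euler's formula V - E + F = 2 holds
   (genus 0), with E = #|D| / 2. *)
Definition cubic_plane_graph : Prop :=
  [/\ (forall x, e (e x) = x) /\ (forall x, e x != x),
      forall x, fingraph.order n x = 3,
      forall x y, connect [rel a b | (b == n a) || (b == e a)] x y,
      forall x y, vertex_of x = vertex_of y ->
                  vertex_of (e x) = vertex_of (e y) -> x = y
    & (#|vertices| + #|faces|).*2 = #|D| + 4].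

Definition bipartite_map : Prop :=
  exists c : D -> bool, forall x, c (n x) = c x /\ c (e x) != c x.

Definition proper_face_coloring (col : D -> 'I_3) : Prop :=
  forall x, col (face_perm x) = col x /\ col (e x) != col x.

(* The graph obtained by contracting each face of colour 2 (class C_3)
   to a single vertex: its vertices are the faces of colour 2; two distinct
   such faces are adjacent iff some edge of G joins a vertex of the first
   to a vertex of the second. *)
Definition contracted_vertices (col : D -> 'I_3) : {set {set D}} :=
  [set face_of x | x in [set y | val (col y) == 2]].

Definition incident (A : {set D}) (x : D) : bool :=
  [exists z, fconnect n x z && (z \in A)].

Definition contracted_adj : rel {set D} :=
  fun A B => (A != B) && [exists x, incident A x && incident B (e x)].

Definition graph_adj : rel {set D} :=
  fun A B => [exists x in A, e x \in B].

Definition hamiltonian : Prop :=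
  exists s : seq {set D},
    [/\ uniq s, forall A, (A \in vertices) = (A \in s), 2 < size s
      & path.cycle graph_adj s].
End Maps.

Definition k_connected (T : finType) (V : {set T}) (adj : rel T) (k : nat) : Prop :=
  k < #|V| /\
  forall S : {set T}, #|S| < k ->
    forall x y, x \in V :\: S -> y \in V :\: S ->
      connect [rel a b | [&& a \in V :\: S, b \in V :\: S & adj a b]] x y.

(* Main.v *)
(* Write K for the set of darts on faces of colour 2; they correspond to the vertices of G. Contracting
   the faces of colour 2 turns G into an Eulerian triangulation H of the sphere, a map on K with vertex
   rotation f, edge involution h and faces t = f^-1 h of size 3, the hexagons.

   Replacing f by h on the corners of a set Y of triangles gives a permutation of K that still moves every
   vertex of G to a neighbour. It is f composed with t restricted to Y, so by the genus inequality it is a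
   single cycle, i.e. a hamiltonian cycle of G, as soon as Y connects the vertices of H and
   2|Y| + 1 = |V(H)|. By duality such a Y arises from a spanning tree of the dual cubic graph whose
   co-tree edges can be oriented with even indegrees: take for Y the triangles of positive indegree.

   Such a tree exists by Nebesky's criterion, in terms of edge cuts between the parts of a partition.
   Since H is 4-connected, dual cuts have at least 3 edges, and at least 4 unless one side is a single
   triangle; if |V(H)| is odd this is enough. If |V(H)| is even, H has a vertex of degree 4 with
   triangles t1, t2, t3, t4; it is split so that t1 and t3 become one face, which makes the number of
   vertices odd, and t2 and t4 are put in Y. The dual graph with t2 and t4 deleted and t1 and t3
   identified still satisfies the criterion, because slacks are even. *)
Require Import Defs.
From mathcomp Require Import all_boot fingroup perm.
From mathcomp Require Import zify.
Set Implicit Arguments. Unset Strict Implicit. Unset Printing Implicit Defensive.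

(** * Orientations and trees of multigraphs *)

(** A spanning tree of the dual leaves |V(H)| - 1 co-tree edges, and each triangle of positive even
    indegree takes at least two of them. So Y has at most (|V(H)| - 1) / 2 triangles, and this upper
    bound is all that the genus inequality needs. The indegrees can all be even only if |V(H)| is
    odd: this is the obstacle that forces a second case.

    The partition criterion is checked part by part. A set of k triangles with i inner edges and a
    cut of d edges satisfies 3k = 2i + d, while twice its load is 2i + 2 or 2i + 4. So twice the
    load is at most 3k if d >= 4, or if d = 3 and the parity bit is 0. For d = 3 the part or its
    complement is one triangle, and Euler's formula gives the parity.

    In the even case the merged face of t1 and t3 must stay out of Y, because the flip does not fit
    the split vertex there. It keeps only two edges in the reduced graph and the tree uses at least
    one of them, so an even indegree is 0. The reduced graph has 3|[A]| = 2|[B]| + 3; counting alone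
    then misses the criterion by one, which parity repairs. *)

Section Multigraph.
Variables (V E : finType).
Implicit Types (s t phi : E -> V) (B S : {set E}) (A X K R : {set V}).

Definition inner s t B X := [set e in B | (s e \in X) && (t e \in X)].

(** Connectivity in cut form, so that no paths have to be handled. Together with #|S|.+1 = #|A| it
    says that [S] is a spanning tree on [A]. *)
Definition connected_by s t A S := forall X, X \subset A -> X != set0 -> X != A ->
  exists2 e, e \in S & (s e \in X) != (t e \in X).

Definition indegree phi B v := #|[set e in B | phi e == v]|.

Lemma sum_indegree phi B X :
  \sum_(v in X) indegree phi B v = #|[set e in B | phi e \in X]|.
Proof.
rewrite -sum1dep_card (partition_big phi (mem X)) /=; last by move=> e /andP[].
apply: eq_bigr => v vX; rewrite /indegree -sum1dep_card.
by apply: eq_bigl => e; case: eqP => [->|]; rewrite ?vX ?andbT ?andbF.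
Qed.

Lemma inner_setD1 s t B X e : e \in B ->
  #|inner s t B X| = #|inner s t (B :\ e) X| + ((s e \in X) && (t e \in X)).
Proof.
move=> eB; rewrite (cardsD1 e (inner s t B X)) !inE eB /= addnC; congr (_ + _).
by apply: eq_card => x; rewrite !inE andbA.
Qed.

Lemma indegree_setU1 phi B v e : e \notin B ->
  indegree phi (e |: B) v = indegree phi B v + (phi e == v).
Proof.
move=> eB; rewrite /indegree (cardsD1 e) !inE eqxx /= addnC; congr (_ + _).
apply: eq_card => x; rewrite !inE; case: eqVneq => //= ->.
by rewrite (negbTE eB).
Qed.

Lemma eq_indegree phi phi' B v : {in B, phi =1 phi'} ->
  indegree phi B v = indegree phi' B v.
Proof.
by move=> eq_phi; apply: eq_card => x; rewrite !inE; case: (boolP (x \in B)) => // /eq_phi ->.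
Qed.

(** Supermodularity is strict here because [e] runs between the two differences: it is counted in
    the union and in neither set on the left. *)
Lemma inner_submod s t B (X Y : {set V}) e : e \in B -> s e \in X -> s e \notin Y -> t e \in Y -> t e \notin X ->
  #|inner s t B X| + #|inner s t B Y| < #|inner s t B (X :|: Y)| + #|inner s t B (X :&: Y)|.
Proof.
move=> eB sX sY tY tX; rewrite -(cardsUI (inner s t B X)).
rewrite -addSn; apply: leq_add; last first.
  by apply: subset_leq_card; apply/subsetP=> x; rewrite !inE => /andP[/and3P[-> -> ->] /and3P[_ -> ->]].
apply: proper_card; apply/properP; split.
  apply/subsetP=> x; rewrite !inE => /orP[] /and3P[-> -> ->] //.
  by rewrite !orbT.
exists e; rewrite !inE ?eB ?sX ?tY ?orbT //.
by rewrite (negbTE sY) (negbTE tX) !andbF.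
Qed.

(* Hakimi's theorem. If neither orientation of an edge [e] can be committed to, then two tight sets
   separate its ends in opposite ways, which supermodularity of [inner] forbids. *)
Lemma orientation_with_indegrees s t B (m : V -> nat) :
    (forall X, #|inner s t B X| <= \sum_(v in X) m v) -> #|B| = \sum_v m v ->
  exists phi, (forall e, e \in B -> phi e \in [set s e; t e])
           /\ (forall v, indegree phi B v = m v).
Proof.
elim/ltn_ind: {B}#|B| {-2}B (erefl #|B|) m => k IH B cB m le_m eq_m.
case: (set_0Vmem B) => [B0|[e eB]].
  exists s; split=> [e|v]; first by rewrite B0 inE.
  rewrite /indegree B0; apply/eqP; rewrite eq_sym.
  have -> : [set e in set0 | s e == v] = set0 by apply/setP=> x; rewrite !inE.
  rewrite cards0; move: eq_m; rewrite B0 cards0 => /esym/eqP; rewrite sum_nat_eq0.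
  by move/forallP/(_ v).
have step v : v \in [set s e; t e] ->
    (forall X, v \in X -> #|inner s t (B :\ e) X| < \sum_(v in X) m v) ->
  exists phi, (forall e, e \in B -> phi e \in [set s e; t e])
           /\ (forall v, indegree phi B v = m v).
  move=> ve ltm.
  pose m' u := m u - (u == v).
  (* Without this the subtraction in [m'] could truncate; the singleton of [v] already forces a
     positive demand. *)
  have mv : 0 < m v by have := ltm [set v] (set11 v); rewrite big_set1; apply: leq_trans.
  have summ' X : \sum_(u in X) m u = \sum_(u in X) m' u + (v \in X).
    case: (boolP (v \in X)) => vX.
      rewrite !(bigD1 v vX) /= /m' eqxx.
      rewrite [in RHS](eq_bigr m); first by lia.
      by move=> u /andP[_ /negbTE ->]; rewrite subn0.
    rewrite addn0; apply: eq_bigr => u uX; rewrite /m'; case: eqVneq => [uv|]; last by rewrite subn0.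
    by rewrite -uv uX in vX.
  have cB' : #|B| = #|B :\ e|.+1 by rewrite (cardsD1 e B) eB.
  have [|||phi [phiB deg]] := IH #|B :\ e| _ (B :\ e) (erefl _) m'.
  - by rewrite -cB cB'.
  - move=> X; case: (boolP (v \in X)) => vX.
      by have := ltm X vX; rewrite summ' vX addn1 ltnS.
    apply: leq_trans (_ : #|inner s t B X| <= _); last first.
      by have := le_m X; rewrite summ' (negbTE vX) addn0.
    by rewrite (inner_setD1 s t X eB) leq_addr.
  - have sumT (F : V -> nat) : \sum_u F u = \sum_(u in [set: V]) F u.
      by apply: eq_bigl => u; rewrite inE.
    by have := eq_m; rewrite !sumT summ' inE cB' addn1 => -[].
  exists (fun x => if x == e then v else phi x); split=> [x xB|u].
    by case: eqVneq => [->//|xe]; apply: phiB; rewrite !inE xe.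
  rewrite -(setD1K eB) indegree_setU1 ?setD11 // eqxx.
  rewrite (@eq_indegree _ phi); last by move=> x; rewrite !inE => /andP[/negbTE ->].
  rewrite deg /m'; case: (eqVneq u v) => [->|_]; first by rewrite subnK.
  by rewrite subn0 addn0.
pose tight v (X : {set V}) := (v \in X) && (\sum_(v in X) m v <= #|inner s t (B :\ e) X|).
case: (boolP [exists X, tight (s e) X]) => [/existsP[X /andP[sX Xt]]|]; last first.
  rewrite negb_exists => /forallP noX; apply: (step (s e)); first by rewrite !inE eqxx.
  by move=> X sX; have := noX X; rewrite /tight sX /= -ltnNge.
case: (boolP [exists X, tight (t e) X]) => [/existsP[Y /andP[tY Yt]]|]; last first.
  rewrite negb_exists => /forallP noX; apply: (step (t e)); first by rewrite !inE eqxx orbT.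
  by move=> Y tY; have := noX Y; rewrite /tight tY /= -ltnNge.
have tX : t e \notin X.
  by apply/negP=> tX; have := le_m X; rewrite (inner_setD1 s t X eB) sX tX; lia.
have sY : s e \notin Y.
  by apply/negP=> sY; have := le_m Y; rewrite (inner_setD1 s t Y eB) sY tY; lia.
have := inner_submod eB sX sY tY tX.
have := le_m (X :|: Y); have := le_m (X :&: Y).
have := inner_setD1 s t X eB; have := inner_setD1 s t Y eB.
rewrite (negbTE tX) (negbTE sY) andbF /=.
have : \sum_(v in X :|: Y) m v + \sum_(v in X :&: Y) m v = \sum_(v in X) m v + \sum_(v in Y) m v.
  rewrite (big_setID X) /= setUK setDUl setDv set0U [in RHS]addnC.
  by rewrite [\sum_(v in Y) m v](big_setID X) /= [Y :&: X]setIC; lia.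
lia.
Qed.

Lemma indegree_subset phi B S v : S \subset B ->
  indegree phi B v = indegree phi (B :\: S) v + indegree phi S v.
Proof.
move=> sSB; rewrite /indegree -(cardsID S) addnC; congr (_ + _).
  by apply: eq_card => x; rewrite !inE; case: (x \in S); rewrite /= ?andbF ?andbT.
by apply: eq_card => x; rewrite !inE; have := subsetP sSB x;
  case: (x \in S) => [->|_]; rewrite //= ?andbT ?andbF.
Qed.

(** Grown greedily from [r]: while the reached set R is not all of [A], the hypothesis for its
    complement gives an edge with head outside R and other end in R. Each vertex is reached by one
    edge pointing to it, whence the indegrees. *)
Lemma arborescence s t phi A B r :
    r \in A -> (forall e, e \in B -> s e \in A /\ t e \in A) ->
    (forall e, e \in B -> phi e \in [set s e; t e]) ->
    (forall X, X \subset A -> X != set0 -> r \notin X ->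
       exists e, [/\ e \in B, phi e \in X & ~~ ((s e \in X) && (t e \in X))]) ->
  exists S, [/\ S \subset B, connected_by s t A S
    & forall v, v \in A -> indegree phi S v = (v != r)].
Proof.
move=> rA BA phiB rconn.
have grow k : k < #|A| -> exists R S, [/\ R \subset A, r \in R, #|R| = k.+1 &
  [/\ S \subset B, (forall e, e \in S -> s e \in R /\ t e \in R),
   connected_by s t R S & forall v, v \in A -> indegree phi S v = (v \in R) && (v != r)]].
  elim: k => [|k IH] kA.
    exists [set r], set0; split; [by rewrite sub1set|by rewrite set11|by rewrite cards1|].
    split; [by rewrite sub0set|by move=> e; rewrite in_set0| |].
      by move=> X; rewrite subset1 => /orP[] /eqP ->; rewrite eqxx.
    move=> v _; rewrite inE andbN; apply/eqP; rewrite cards_eq0; apply/eqP/setP=> e.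
    by rewrite !inE.
  have [R [S [RA rR cR [SB SR Sconn Sdeg]]]] := IH (ltnW kA).
  have [||| e [eB eX eN]] := rconn (A :\: R); first exact: subsetDl.
    by rewrite -card_gt0 cardsDS // cR subn_gt0.
    by rewrite inE rR.
  set v := phi e in eX; have [vA vR] : v \in A /\ v \notin R by move: eX; rewrite inE => /andP[].
  have [sA tA] := BA e eB.
  have ends : (s e == v) && (t e \in R) || (t e == v) && (s e \in R).
    have := phiB e eB; rewrite -/v !inE => /orP[] /eqP ve.
      by move: eN; rewrite -ve eqxx !inE vR vA tA /= andbT negbK => ->.
    by move: eN; rewrite -ve eqxx !inE vR vA sA /= !andbT negbK orbC => ->.
  have eS : e \notin S by apply/negP=> /SR [sR tR]; have := phiB e eB; rewrite -/v !inE;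
    move=> /orP[] /eqP ve; move: vR; rewrite ve ?sR ?tR.
  exists (v |: R), (e |: S); split.
  - by apply/subsetP=> x; rewrite !inE => /orP[/eqP ->|/(subsetP RA)].
  - by rewrite !inE rR orbT.
  - by rewrite cardsU1 vR cR.
  split.
  - by apply/subsetP=> x; rewrite !inE => /orP[/eqP ->|/(subsetP SB)].
  - move=> x; rewrite !inE => /orP[/eqP ->|/SR [-> ->]]; last by rewrite !orbT.
    by case/orP: ends => /andP[/eqP -> ->]; rewrite eqxx ?orbT.
  - move=> Y sY Y0 YR.
    have [YR0|YR0] := eqVneq (Y :&: R) set0.
      have vY : v \in Y.
        have /set0Pn[y yY] := Y0; have := subsetP sY y yY; rewrite !inE => /orP[/eqP <- //|yR].
        by have := in_set0 y; rewrite -YR0 inE yY yR.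
      have notY x : x \in R -> x \notin Y.
        by move=> xR; apply/negP=> xY; have := in_set0 x; rewrite -YR0 inE xY xR.
      exists e; first by rewrite !inE eqxx.
      by case/orP: ends => /andP[/eqP -> /notY /negbTE ->]; rewrite vY.
    have [YR1|YR1] := eqVneq (Y :&: R) R.
      have vY : v \notin Y.
        apply: contra YR => vY; rewrite eqEsubset sY /= subUset sub1set vY /=.
        by rewrite -YR1 subsetIl.
      have inY x : x \in R -> x \in Y by rewrite -{1}YR1 inE => /andP[].
      exists e; first by rewrite !inE eqxx.
      by case/orP: ends => /andP[/eqP -> /inY ->]; rewrite (negbTE vY).
    have [x xS] := Sconn _ (subsetIr _ _) YR0 YR1; have [sR tR] := SR x xS.
    by rewrite !inE sR tR !andbT => xY; exists x => //; rewrite !inE xS orbT.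
  move=> u uA; rewrite indegree_setU1 // Sdeg // -/v !inE eq_sym.
  case: (eqVneq u v) => [->|]; last by rewrite addn0.
  by rewrite (negbTE vR) /=; case: eqVneq => // vr; rewrite -vr rR in vR.
have cA : 0 < #|A| by rewrite card_gt0; apply/set0Pn; exists r.
have A0 : #|A|.-1 < #|A| by rewrite ltn_predL.
have [R [S [RA rR cR [SB SR Sconn Sdeg]]]] := grow _ A0.
have eqR : R = A by apply/eqP; rewrite eqEcard RA cR prednK /=.
rewrite eqR in Sconn Sdeg; exists S; split=> // v vA; by rewrite Sdeg // vA.
Qed.

(** Hakimi's theorem is applied to the demands [m] plus one at every vertex except a root [r]. The
    strict inequality makes every set avoiding [r] be entered by an edge, so an arborescence can be
    removed; it takes exactly the added units and leaves [m]. *)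
Lemma tree_with_coindegrees s t A B (m : V -> nat) : A != set0 ->
    (forall e, e \in B -> s e \in A /\ t e \in A) ->
    (forall X, X \subset A -> X != set0 -> #|inner s t B X| < \sum_(v in X) (m v).+1) ->
    #|B|.+1 = \sum_(v in A) (m v).+1 ->
  exists S phi, [/\ S \subset B, connected_by s t A S, #|S|.+1 = #|A|,
    (forall e, e \in B -> phi e \in [set s e; t e])
    & forall v, v \in A -> indegree phi (B :\: S) v = m v].
Proof.
case/set0Pn=> r rA BA ltm eqm.
pose m' v := if v \in A then m v + (v != r) else 0.
have sumA X : X \subset A -> \sum_(v in X) (m v).+1 = \sum_(v in X) m' v + (r \in X).
  move=> XA; case: (boolP (r \in X)) => rX.
    rewrite !(bigD1 r rX) /= /m' rA eqxx addn0 [in RHS](eq_bigr (fun v => (m v).+1)); first by lia.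
    by move=> v /andP[vX ->]; rewrite (subsetP XA) // addn1.
  rewrite addn0; apply: eq_bigr => v vX; rewrite /m' (subsetP XA) //.
  by case: eqVneq => [vr|]; [rewrite -vr vX in rX | rewrite addn1].
have sumI X : \sum_(v in X) m' v = \sum_(v in X :&: A) m' v.
  rewrite (big_setID A) /= [X in _ + X]big1 ?addn0 // => v; rewrite inE => /andP[vA _].
  by rewrite /m' (negbTE vA).
have innerI X : inner s t B X = inner s t B (X :&: A).
  apply/setP=> e; rewrite !inE; case: (boolP (e \in B)) => //= /BA [-> ->].
  by rewrite !andbT.
have [||phi [phiB deg]] := @orientation_with_indegrees s t B m'.
- move=> X; rewrite innerI sumI; have [->|X0] := eqVneq (X :&: A) set0.
    rewrite big_set0 leqn0 cards_eq0; by apply/eqP/setP=> e; rewrite !inE !andbF.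
  by have := ltm _ (subsetIr X A) X0; rewrite sumA ?subsetIr //; case: (_ \in _); lia.
- have -> : \sum_v m' v = \sum_(v in [set: V]) m' v by apply: eq_bigl => v; rewrite inE.
  by rewrite sumI setTI; move: eqm; rewrite sumA // rA addn1 => -[].
have [||X XA X0 rX|S [SB Sconn Sdeg]] := @arborescence s t phi A B r rA => //.
  have : #|inner s t B X| < #|[set e in B | phi e \in X]|.
    rewrite -sum_indegree (eq_bigr m') => [|v _]; last exact: deg.
    by have := ltm X XA X0; rewrite sumA // (negbTE rX) addn0.
  case: (boolP ([set e in B | phi e \in X] \subset inner s t B X)) => [/subset_leq_card|].
    by rewrite ltnNge => ->.
  case/subsetPn=> e; rewrite inE => /andP[eB eX]; rewrite inE eB /= => eN _.
  by exists e.
have degD v : v \in A -> indegree phi (B :\: S) v = m v.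
  move=> vA; have := deg v; rewrite (indegree_subset _ _ SB) (Sdeg _ vA) /m' vA; lia.
exists S, phi; split=> //.
have : \sum_(v in A) indegree phi S v = #|S|.
  rewrite sum_indegree; apply: eq_card => e; rewrite inE; case: (boolP (e \in S)) => //= eS.
  have eB := subsetP SB e eS; have [sA tA] := BA e eB.
  by have := phiB e eB; rewrite !inE => /orP[] /eqP ->; rewrite ?sA ?tA.
rewrite (eq_bigr (fun v => (v != r) : nat) Sdeg) => <-.
rewrite (bigD1 r rA) /= eqxx add0n (eq_bigr (fun=> 1)); last by move=> v /andP[_ ->].
by rewrite sum1dep_card (cardsD1 r A) rA add1n; congr _.+1; apply: eq_card => v; rewrite !inE andbC.
Qed.

End Multigraph.

(** * Trees with prescribed co-tree parities *)

Lemma odd_sum (I : Type) (r : seq I) (p : pred I) (F G : I -> nat) :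
    (forall i, p i -> odd (F i) = odd (G i)) ->
  odd (\sum_(i <- r | p i) F i) = odd (\sum_(i <- r | p i) G i).
Proof.
by move=> eqFG; elim/big_rec2: _ => // i x y pi eqxy; rewrite !oddD eqxy eqFG.
Qed.

Section Partitions.
Variable V : finType.
Implicit Types (A K X : {set V}) (P Q R W : {set {set V}}).

Lemma partition_set1 X : X != set0 -> partition [set X] X.
Proof.
by move=> X0; rewrite /partition /cover big_set1 eqxx trivIset1 inE eq_sym X0.
Qed.

(** Used in both directions: to merge a family of blocks into one, and to refine a single block. *)
Lemma partition_swap P A R Q : partition P A -> R \subset P -> partition Q (cover R) ->
  partition ((P :\: R) :|: Q) A /\ [disjoint P :\: R & Q].
Proof.
move=> PA RP QR; have [/eqP cP tP nP] := and3P PA; have [/eqP cQ tQ nQ] := and3P QR.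
have disj K L : K \in P :\: R -> L \in Q -> [disjoint K & L].
  rewrite inE => /andP[KR KP] LQ.
  have sL : L \subset cover R by rewrite -cQ; apply: (bigcup_sup L).
  apply: disjointWr sL _; apply/bigcup_disjointP => M MR.
  apply: (trivIsetP tP) => //; first exact: subsetP MR.
  by apply: contraNneq KR => ->.
have PRQ : [disjoint P :\: R & Q].
  apply/pred0P=> K /=; apply/negP=> /andP[KP KQ].
  have /pred0P := disj K K KP KQ; case/set0Pn: (partition_neq0 QR KQ) => x xK /(_ x) /=.
  by rewrite xK.
split=> //; apply/and3P; split.
- rewrite /cover bigcup_setU -/(cover _) -/(cover Q) cQ -cP.
  apply/eqP/setP=> x; apply/setUP/bigcupP => [[]/bigcupP[K KP xK]|[K KP xK]].
  + by exists K => //; move: KP; rewrite inE => /andP[].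
  + by exists K => //; apply: subsetP KP.
  case: (boolP (K \in R)) => KR; [right|left]; apply/bigcupP; exists K => //.
  by rewrite inE KR.
- apply/trivIsetP=> K L /setUP[] KX /setUP[] LX neq.
  + by apply: (trivIsetP tP) => //; [move: KX | move: LX]; rewrite inE => /andP[].
  + exact: disj.
  + by rewrite disjoint_sym; apply: disj.
  + exact: (trivIsetP tQ).
- by rewrite !inE negb_or nQ negb_and nP orbT.
Qed.

Lemma sum_swap P A R Q (F : {set V} -> nat) : partition P A -> R \subset P -> partition Q (cover R) ->
  \sum_(K in (P :\: R) :|: Q) F K + \sum_(K in R) F K = \sum_(K in P) F K + \sum_(K in Q) F K.
Proof.
move=> PA RP QR; have [_ disj] := partition_swap PA RP QR.
rewrite (big_setID (P :\: R)) /= setUK setDUl setDv set0U.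
have -> : Q :\: (P :\: R) = Q by apply/setDidPl; rewrite disjoint_sym.
rewrite [\sum_(K in P) _](big_setID R) /= (setIidPr RP); lia.
Qed.

End Partitions.

Section Loads.
Variables (V E : finType) (s t : E -> V).
Implicit Types (B S : {set E}) (A X K R : {set V}) (w : V -> bool).

(* When [K] is connected, this is the parity of its cyclomatic number plus the demands [w] on it. *)
Definition parity_bit B w K :=
  odd (#|inner s t B K| + #|K| + 1 + \sum_(v in K) w v).

Definition load B w K := #|inner s t B K| + parity_bit B w K + 1.

Lemma odd_load B w K : odd (load B w K) = odd (\sum_(v in K) (w v + 1)).
Proof.
rewrite big_split /= sum1_card /load /parity_bit !oddD oddb.
by case: (odd #|_|); case: (odd #|_|); case: (odd (\sum_(_ in _) _)).
Qed.

Lemma odd_sum_load B w P A : partition P A ->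
  odd (\sum_(K in P) load B w K) = odd (\sum_(v in A) (w v + 1)).
Proof.
move=> PA; rewrite (set_partition_big _ PA) /=.
by apply: odd_sum => K _; exact: odd_load.
Qed.

Lemma odd_sum_flip w (c : V -> nat) K :
  odd (\sum_(v in K) (w v (+) odd (c v))) = odd (\sum_(v in K) w v) (+) odd (\sum_(v in K) c v).
Proof.
by rewrite -oddD -big_split /=; apply: odd_sum => v _; rewrite oddD oddb; case: (w v); case: (odd _).
Qed.

(** Nebesky's criterion: the edges between the blocks number at least |P| - 1 plus the number of
    blocks with odd bit. Adding the edges inside blocks to both sides gives this form. *)
Definition loads_fit A B w := forall P, partition P A -> \sum_(K in P) load B w K <= #|B|.+1.

(** The one-block partition leaves no room for a parity bit, so that bit is 0; this fixes the parity
    of [B]. *)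
Lemma loads_fit_odd A B w : A != set0 -> inner s t B A = B -> loads_fit A B w ->
  odd #|B| = ~~ odd (\sum_(v in A) (w v + 1)).
Proof.
move=> A0 BA /(_ _ (partition_set1 A0)); rewrite big_set1 -(odd_load B) /load BA.
by case: (parity_bit _ _ _) => /=; [rewrite !addn1 ltnn | rewrite addn0 addn1 /= negbK].
Qed.

End Loads.

Section ParityTreeSteps.
Variables (V E : finType) (s t : E -> V).
Implicit Types (B S : {set E}) (A X K : {set V}) (P Q W : {set {set V}}) (w : V -> bool).

Definition has_parity_tree A B w := exists S phi,
  [/\ S \subset B, connected_by s t A S, #|S|.+1 = #|A|,
    (forall e, e \in B -> phi e \in [set s e; t e])
    & forall v, v \in A -> odd (indegree phi (B :\: S) v) = w v].

Lemma loads_fit_slack A B w P : A != set0 -> (forall e, e \in B -> s e \in A /\ t e \in A) ->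
    loads_fit s t A B w -> partition P A -> \sum_(K in P) load s t B w K != #|B|.+1 ->
  (\sum_(K in P) load s t B w K).+2 <= #|B|.+1.
Proof.
move=> A0 BA fit PA neq.
have innA : inner s t B A = B.
  by apply/setP=> e; rewrite inE; case: (boolP (e \in B)) => //= /BA[-> ->].
have := loads_fit_odd A0 innA fit; rewrite -(odd_sum_load s t B w PA).
have := fit P PA; rewrite leq_eqVlt (negbTE neq) /= => lt_load.
move: lt_load; set x := \sum_(K in P) _; rewrite ltnS leq_eqVlt => /orP[/eqP ->|]; last by [].
by case: odd.
Qed.

Lemma card_cross_split A B P W : partition P A -> W \subset P ->
    (forall e, e \in B -> s e \in A /\ t e \in A) ->
  #|inner s t B (cover W)| = \sum_(K in W) #|inner s t B K| +
    #|inner (pblock P \o s) (pblock P \o t) [set e in B | pblock P (s e) != pblock P (t e)] W|.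
Proof.
move=> PA WP BA; have [/eqP cP tP nP] := and3P PA.
have inW v : v \in A -> (v \in cover W) = (pblock P v \in W).
  move=> vA; apply/bigcupP/idP => [[K KW vK]|vW].
    by rewrite (def_pblock tP (subsetP WP K KW) vK).
  by exists (pblock P v) => //; rewrite mem_pblock cP.
set B1 := [set e in B | pblock P (s e) == pblock P (t e)].
have -> : \sum_(K in W) #|inner s t B K| = #|[set e in B1 | pblock P (s e) \in W]|.
  rewrite -sum_indegree; apply: eq_bigr => K KW; apply: eq_card => e; rewrite !inE.
  case: (boolP (e \in B)) => //= /BA [sA tA].
  have inK v : v \in A -> (v \in K) = (pblock P v == K).
    move=> vA; apply/idP/eqP => [/def_pblock -> //|<-]; first exact: subsetP KW.
    by rewrite mem_pblock cP.
  rewrite !inK // andbC; case: (eqVneq (pblock P (s e)) K) => [->|]; last by rewrite !andbF.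
  by rewrite !andbT eq_sym.
set B2 := inner _ _ _ W.
have I0 : [set e in B1 | pblock P (s e) \in W] :&: B2 = set0.
  by apply/setP=> e; rewrite !inE /=; case: eqVneq; rewrite ?andbF.
rewrite -cardsUI I0 cards0 addn0.
apply: eq_card => e; rewrite !inE /=; case: (boolP (e \in B)) => //= /BA [sA tA].
rewrite !inW //; case: eqVneq => [->|_] /=; first by rewrite andbb orbF.
by [].
Qed.

(** Puts [e] into the co-tree with head [s e], which flips the demand there. If [e] lies inside a
    block, its load and |B| both drop by 1. If [e] crosses, |B| drops by 1 and the load of one block
    may rise by 1, which the even slack of at least 2 absorbs. *)
Lemma parity_tree_delete A B w e :
    A != set0 -> (forall e, e \in B -> s e \in A /\ t e \in A) ->
    loads_fit s t A B w -> e \in B ->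
    (forall P, partition P A -> 1 < #|P| -> \sum_(K in P) load s t B w K != #|B|.+1) ->
  loads_fit s t A (B :\ e) (fun v => w v (+) (v == s e)).
Proof.
move=> A0 BA fit eB loose P PA; have [/eqP cP tP nP] := and3P PA.
have [sA tA] := BA e eB.
have cB : #|B| = #|B :\ e|.+1 by rewrite (cardsD1 e B) eB.
set w' := fun v : V => w v (+) (v == s e).
have mem_sum K : K \in P -> (s e \in K) = (K == pblock P (s e)).
  move=> KP; apply/idP/eqP => [/def_pblock -> //|->].
  by rewrite mem_pblock cP.
have oddw K : odd (\sum_(v in K) w' v) = odd (\sum_(v in K) w v) (+) (s e \in K).
  have -> : (s e \in K) = odd (\sum_(v in K) (v == s e)).
    case: (boolP (s e \in K)) => sK.
      rewrite (bigD1 (s e) sK) /= eqxx big1 // => v /andP[_ /negbTE ->] //.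
    by rewrite big1 // => v vK; case: eqVneq => // vs; rewrite -vs vK in sK.
  by rewrite -odd_sum_flip; apply: odd_sum => v _; rewrite /w' !oddb.
have sum1 : \sum_(K in P) (s e \in K) = 1.
  rewrite (bigD1 (pblock P (s e))) ?pblock_mem ?cP //= mem_pblock cP sA big1 //.
  by move=> K /andP[KP /negbTE]; rewrite mem_sum // => ->.
case: (boolP (t e \in pblock P (s e))) => te.
  have ld K : K \in P -> load s t B w K = load s t (B :\ e) w' K + (s e \in K).
    move=> KP; rewrite /load /parity_bit (inner_setD1 s t K eB) !oddD oddw.
    have -> : (s e \in K) && (t e \in K) = (s e \in K).
      by rewrite mem_sum //; case: eqVneq => //= ->.
    by case: (s e \in K); rewrite /= ?addn0 ?addbF ?addbT ?addNb ?addbN /=; lia.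
  have := fit P PA; rewrite (eq_bigr _ ld) big_split /= sum1; lia.
have ld K : K \in P -> load s t (B :\ e) w' K <= load s t B w K + (s e \in K).
  move=> KP; rewrite /load /parity_bit (inner_setD1 s t K eB) !oddD oddw.
  have -> : (s e \in K) && (t e \in K) = false.
    by rewrite mem_sum //; case: eqVneq => //= ->; apply: negbTE.
  case: (s e \in K); rewrite /= ?addn0 ?addbF ?addbT ?oddb; first by case: (_ (+) _); lia.
  by [].
have cardP : 1 < #|P|.
  rewrite (cardD1 (pblock P (s e))) (cardD1 (pblock P (t e))) !inE !pblock_mem ?cP // andbT.
  case: eqVneq => // eqst; move: te; rewrite -eqst mem_pblock cP tA //.
have := loads_fit_slack A0 BA fit PA (loose P PA cardP).
have : \sum_(K in P) load s t (B :\ e) w' K <= \sum_(K in P) (load s t B w K + (s e \in K)).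
  exact: leq_sum.
rewrite [X in _ <= X]big_split /= sum1; lia.
Qed.

End ParityTreeSteps.

Lemma leq_addb_odd (b : bool) k : b (+) odd k <= b + k.
Proof. by have := @odd_gt0 k; case: (odd k) => [/(_ isT)|_]; case: b => //=; lia. Qed.

Section ParityTreeTheorem.
Variables (V E : finType) (s t : E -> V).
Implicit Types (B S : {set E}) (A X Y K L : {set V}) (P Q W : {set {set V}}) (w : V -> bool).

Lemma parity_tree_loose A B w n :
    A != set0 -> (forall e, e \in B -> s e \in A /\ t e \in A) -> loads_fit s t A B w ->
    (forall P, partition P A -> 1 < #|P| -> \sum_(K in P) load s t B w K != #|B|.+1) ->
    #|A| + #|B| = n ->
    (forall B' w', #|A| + #|B'| < n -> (forall e, e \in B' -> s e \in A /\ t e \in A) ->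
       loads_fit s t A B' w' -> has_parity_tree s t A B' w') ->
  has_parity_tree s t A B w.
Proof.
move=> A0 BA fit loose cn IH.
have [A1|A2] := leqP #|A| 1.
  have /cards1P[v Av] : #|A| == 1 by rewrite eqn_leq A1 card_gt0.
  have eB e : e \in B -> s e = v /\ t e = v by move=> /BA; rewrite Av !inE => -[/eqP-> /eqP->].
  exists set0, s; split.
  - exact: sub0set.
  - by move=> X; rewrite Av subset1 => /orP[] /eqP ->; rewrite eqxx.
  - by rewrite cards0 Av cards1.
  - by move=> e _; rewrite !inE eqxx.
  have innA : inner s t B A = B.
    by apply/setP=> e; rewrite inE; case: (boolP (e \in B)) => //= /BA[-> ->].
  move=> u; rewrite Av inE => /eqP ->; have := loads_fit_odd A0 innA fit.
  rewrite Av big_set1 oddD oddb /= addbT negbK => <-; congr odd; apply: eq_card => e.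
  rewrite !inE andTb; case: (boolP (e \in B)) => //= /eB[-> _]; exact: eqxx.
have [v vA] := set0Pn _ A0.
have Av0 : A :\ v != set0 by rewrite -card_gt0; have := cardsD1 v A; rewrite vA; lia.
have disjv : [disjoint [set v] & A :\ v] by rewrite disjoints1 !inE eqxx.
have PA : partition ([set v] |: [set A :\ v]) A.
  rewrite -[X in partition _ X](setD1K vA); apply: partitionU1 => //; first exact: partition_set1.
  by apply/set0Pn; exists v; rewrite inE.
(* The partition into [v] and the rest has total load at least 2, so [B] cannot be empty. *)
have [e eB] : exists e, e \in B.
  apply/set0Pn; rewrite -card_gt0.
  have neq : [set v] != A :\ v.
    by apply: contraTneq disjv => <-; rewrite disjoints1 set11.
  have := fit _ PA; rewrite big_setU1 ?inE //= big_set1 /load; clear; lia.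
have cB : #|B| = #|B :\ e|.+1 by rewrite (cardsD1 e B) eB.
have BeA x : x \in B :\ e -> s x \in A /\ t x \in A by rewrite inE => /andP[_ /BA].
have [|S [phi [SB Sconn cS phiB par]]] := IH _ _ _ BeA (parity_tree_delete A0 BA fit eB loose).
  by rewrite -cn cB addnS.
have eS : e \notin S by apply/negP=> /(subsetP SB); rewrite !inE eqxx.
exists S, (fun x => if x == e then s e else phi x); split=> //.
- by apply: subset_trans SB _; exact: subsetDl.
- move=> x xB; case: eqVneq => [->|xe]; first by rewrite !inE eqxx.
  by apply: phiB; rewrite !inE xe.
move=> u uA; have -> : B :\: S = e |: (B :\ e :\: S).
  by apply/setP=> x; rewrite !inE; case: eqVneq => [->|]; rewrite ?eS ?eB.
rewrite indegree_setU1 ?inE ?eqxx ?andbF // (@eq_indegree _ _ _ phi); last first.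
  by move=> x; rewrite !inE => /and3P[_ /negbTE ->].
by rewrite oddD par // oddb [s e == u]eq_sym -addbA addbb addbF.
Qed.

(** The blocks of [P] are contracted. A tree of the quotient is chosen so that the co-tree edges
    entering each block number exactly its parity bit; then every block, with demands corrected by
    these edges, has smaller size and satisfies the criterion itself. The trees of the blocks and of
    the quotient together form the tree sought. *)
Lemma parity_tree_glue A B w P :
    A != set0 -> (forall e, e \in B -> s e \in A /\ t e \in A) -> loads_fit s t A B w ->
    partition P A -> 1 < #|P| -> \sum_(K in P) load s t B w K = #|B|.+1 ->
    (forall Q, partition Q A -> #|P| < #|Q| -> \sum_(K in Q) load s t B w K != #|B|.+1) ->
    (forall A' B' w', A' != set0 -> #|A'| + #|B'| < #|A| + #|B| ->
       (forall e, e \in B' -> s e \in A' /\ t e \in A') ->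
       loads_fit s t A' B' w' -> has_parity_tree s t A' B' w') ->
  has_parity_tree s t A B w.
Proof.
move=> A0 BA fit PA cardP tightP finest IH.
have [/eqP cP tP nP] := and3P PA.
pose ps := pblock P \o s; pose pt := pblock P \o t.
set B0 := [set e in B | pblock P (s e) != pblock P (t e)].
have inA v K : K \in P -> v \in K -> v \in A.
  by move=> KP vK; rewrite -cP; apply/bigcupP; exists K.
have inP v : v \in A -> pblock P v \in P by move=> vA; rewrite pblock_mem ?cP.
have inK v K : v \in A -> K \in P -> (v \in K) = (pblock P v == K).
  move=> vA KP; apply/idP/eqP => [/def_pblock -> //|<-].
  by rewrite mem_pblock cP.
have cross W : W \subset P ->
    #|inner s t B (cover W)| = \sum_(K in W) #|inner s t B K| + #|inner ps pt B0 W|.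
  by move=> WP; apply: card_cross_split PA WP BA.
have sum_load W : \sum_(K in W) load s t B w K =
    \sum_(K in W) #|inner s t B K| + \sum_(K in W) (parity_bit s t B w K).+1.
  by rewrite -big_split; apply: eq_bigr => K _; rewrite /load -addnA addn1.
have [||||S0 [phi0 [SB0 conn0 cS0 phiB0 deg0]]] :=
    @tree_with_coindegrees _ _ ps pt P B0 (parity_bit s t B w).
- by rewrite -card_gt0; apply: leq_trans cardP.
- by move=> e; rewrite inE => /andP[/BA[sA tA] _]; rewrite /ps /pt /= !inP.
(* Merging the blocks of [W] into one cannot raise the total load above that of the tight [P];
   comparing the two sums bounds the quotient edges inside [W]. *)
- move=> W WP W0; have cW0 : cover W != set0.
    have [K KW] := set0Pn _ W0; have KP := subsetP WP K KW.
    have [v vK] := set0Pn _ (partition_neq0 PA KP).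
    by apply/set0Pn; exists v; apply/bigcupP; exists K.
  have cWP := partition_set1 cW0.
  have [PA' _] := partition_swap PA WP cWP.
  have := fit _ PA'; have := sum_swap (load s t B w) PA WP cWP.
  have : #|inner s t B (cover W)| < load s t B w (cover W) by rewrite /load addn1 ltnS leq_addr.
  rewrite big_set1 tightP cross // [\sum_(K in W) load _ _ _ _ _]sum_load.
  set x := \sum_(K in W) #|_|; set y := #|inner _ _ _ W|; set z := \sum_(K in W) _.+1.
  by move: (\sum_(K in _ :|: _) _) (load _ _ _ _ _) => a b; clear; lia.
- have innA : inner s t B (cover P) = B.
    by apply/setP=> e; rewrite inE cP; case: (boolP (e \in B)) => //= /BA[-> ->].
  have := cross P (subxx P); rewrite innA => cB; move: tightP; rewrite sum_load cB.
  have -> : inner ps pt B0 P = B0.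
    apply/setP=> e; rewrite inE; case: (boolP (e \in B0)) => //=; rewrite inE => /andP[/BA[sA tA] _].
    by rewrite /ps /pt /= !inP.
  set z := \sum_(K in P) _.+1; set x := \sum_(K in P) _; clear; lia.
pose hd e := if phi0 e == ps e then s e else t e.
pose C0 := B0 :\: S0.
have hdP e : e \in B0 -> [/\ hd e \in A, pblock P (hd e) = phi0 e & hd e \in [set s e; t e]].
  move=> eB0; have := phiB0 e eB0; move: eB0; rewrite !inE => /andP[/BA[sA tA] _] /orP[]/eqP.
    by rewrite /hd => ->; rewrite eqxx; split=> //; rewrite eqxx.
  by rewrite /hd /ps /= => ->; case: eqVneq => [eqp|_]; rewrite eqxx ?orbT; split=> //; rewrite eqp.
pose c v := indegree hd C0 v.
have sumc K : K \in P -> \sum_(v in K) c v = parity_bit s t B w K.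
  move=> KP; rewrite -deg0 // sum_indegree; apply: eq_card => e; rewrite !inE.
  case: (boolP (e \in B0)); rewrite ?andbF ?andbT //; last by move=> /negbTE eN; rewrite inE in eN; rewrite eN ?andbF.
  move=> eB0; have [hA <- _] := hdP e eB0; by rewrite inK.
(* The [c v] co-tree edges coming from other blocks are already directed at [v]; the block supplies
   the rest modulo 2. *)
pose w1 v := w v (+) odd (c v).
have sub K : K \in P -> has_parity_tree s t K (inner s t B K) w1.
  move=> KP; have K0 := partition_neq0 PA KP.
  have KA : K \subset A by exact: partitionS PA KP.
  apply: IH => //; last 1 first.
  (* For the trivial [Q] the corrected parity bit of [K] is 0. Otherwise refining [P] by [Q] gives a
     finer partition, hence not tight, with slack at least 2; the correction costs at most the old
     bit of [K]. *)
  - move=> Q QK.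
    have innQ Y : Y \subset K -> inner s t (inner s t B K) Y = inner s t B Y.
      move=> YK; apply/setP=> e; rewrite !inE.
      by case: (boolP (s e \in Y)) => [/(subsetP YK) ->|]; case: (boolP (t e \in Y)) => [/(subsetP YK) ->|];
         rewrite ?andbF ?andbT.
    have ld Y : Y \in Q -> load s t (inner s t B K) w1 Y <= load s t B w Y + \sum_(v in Y) c v.
      move=> YQ; have YK := partitionS QK YQ.
      rewrite /load /parity_bit innQ // !oddD odd_sum_flip.
      by rewrite addbA [X in _ <= X]addnAC leq_add2r -addnA leq_add2l leq_addb_odd.
    have [Q1|Q2] := leqP #|Q| 1.
      have [Y YQ] : exists Y, Y \in Q.
        apply/set0Pn; apply: contraNneq K0 => Q0; rewrite -(cover_partition QK) Q0.
        by rewrite /cover big_set0.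
      have QY : Q = [set Y] by apply/esym/eqP; rewrite eqEcard sub1set YQ cards1.
      have YK : Y = K by rewrite -(cover_partition QK) QY /cover big_set1.
      have par0 : parity_bit s t (inner s t B K) w1 K = false.
        by rewrite /parity_bit innQ // oddD odd_sum_flip sumc // oddb addbA -oddD addbb.
      by rewrite QY YK big_set1 /load par0 innQ // addn0 addn1.
    have KP1 : [set K] \subset P by rewrite sub1set.
    have QK' : partition Q (cover [set K]) by rewrite /cover big_set1.
    have [PA' disj] := partition_swap PA KP1 QK'.
    have cPQ : #|P| < #|(P :\: [set K]) :|: Q|.
      have /eqP I0 : (P :\: [set K]) :&: Q == set0 by rewrite setI_eq0.
      by rewrite (cardsD1 K P) KP cardsU I0 cards0 subn0 addnC ltn_add2l.
    have := loads_fit_slack A0 BA fit PA' (finest _ PA' cPQ).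
    have := sum_swap (load s t B w) PA KP1 QK'; rewrite tightP big_set1.
    have : \sum_(Y in Q) load s t (inner s t B K) w1 Y <= \sum_(Y in Q) (load s t B w Y + \sum_(v in Y) c v).
      exact: leq_sum.
    rewrite [X in _ <= X]big_split /= -(set_partition_big _ QK) /= sumc // {4}/load.
    have := leq_b1 (parity_bit s t B w K); clear; lia.
  - have [L LP LK] : exists2 L, L \in P & L != K.
      move: cardP; rewrite (cardsD1 K) KP add1n ltnS card_gt0 => /set0Pn[L].
      by rewrite !inE => /andP[LK LP]; exists L.
    have [v vL] := set0Pn _ (partition_neq0 PA LP).
    rewrite -addSn; apply: leq_add; last by apply: subset_leq_card; apply/subsetP=> e; rewrite inE => /andP[].
    apply: proper_card; apply/properP; split=> //; exists v; first exact: inA vL.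
    by rewrite inK ?(inA _ _ LP vL) // -(def_pblock tP LP vL) ?LK // in LK *.
  - by move=> e; rewrite inE => /and3P[].
have [F FP] : exists F : {set V} -> {set E} * (E -> V), forall K, K \in P ->
  [/\ (F K).1 \subset inner s t B K, connected_by s t K (F K).1, #|(F K).1|.+1 = #|K|,
    (forall e, e \in inner s t B K -> (F K).2 e \in [set s e; t e])
    & forall v, v \in K -> odd (indegree (F K).2 (inner s t B K :\: (F K).1) v) = w1 v].
  apply: (@fin_all_exists _ _ (fun K (SP : {set E} * (E -> V)) => K \in P ->
    [/\ SP.1 \subset inner s t B K, connected_by s t K SP.1, #|SP.1|.+1 = #|K|,
      (forall e, e \in inner s t B K -> SP.2 e \in [set s e; t e])
      & forall v, v \in K -> odd (indegree SP.2 (inner s t B K :\: SP.1) v) = w1 v])).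
  move=> K; case: (boolP (K \in P)) => [/sub[S [phi H]]|]; first by exists (S, phi).
  by exists (set0, s).
pose S1 := [set e in B | (pblock P (s e) == pblock P (t e)) && (e \in (F (ps e)).1)].
pose phi e := if e \in B0 then hd e else (F (ps e)).2 e.
have FB e K : K \in P -> e \in (F K).1 -> [/\ e \in B, ps e = K & pt e = K].
  move=> KP eF; have [FK _ _ _ _] := FP K KP; have := subsetP FK e eF.
  by rewrite inE => /and3P[-> sK tK]; rewrite /ps /pt /= (def_pblock tP KP sK) (def_pblock tP KP tK).
have FS1 e K : K \in P -> e \in (F K).1 -> e \in S1.
  move=> KP eF; have [eB psK ptK] := FB e K KP eF.
  by rewrite inE eB psK eF andbT [pblock P (s e)]psK [pblock P (t e)]ptK eqxx.
have S0B : S0 \subset B.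
  by apply: subset_trans SB0 _; apply/subsetP=> e; rewrite inE => /andP[].
exists (S0 :|: S1), phi; split.
- by rewrite subUset S0B; apply/subsetP=> e; rewrite inE => /andP[].
- move=> X XA X0 XN.
  (* Either [X] cuts a block, whose tree then has a crossing edge, or [X] is a union of blocks and
     the quotient tree provides one. *)
  case: (boolP [exists K in P, (X :&: K != set0) && (X :&: K != K)]) => [/exists_inP[K KP /andP[XK XK']]|].
    have [_ connK _ _ _] := FP K KP; have [e eF eX] := connK _ (subsetIr X K) XK XK'.
    exists e; first by rewrite inE (FS1 e K) ?orbT.
    have [FK _ _ _ _] := FP K KP; have := subsetP FK e eF; rewrite inE => /and3P[_ sK tK].
    by move: eX; rewrite !inE sK tK !andbT.
  rewrite negb_exists_in => /forall_inP noK.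
  pose W := [set K in P | K \subset X].
  have XW v : v \in A -> (v \in X) = (pblock P v \in W).
    move=> vA; have vP := inP v vA; have vv : v \in pblock P v by rewrite mem_pblock cP.
    rewrite inE vP /=; apply/idP/subsetP => [vX|]; last by apply.
    have := noK _ vP; rewrite negb_and negbK negbK => /orP[/eqP XP0|/eqP XP u uP].
      by have := in_set0 v; rewrite -XP0 inE vX vv.
    by move: uP; rewrite -XP inE => /andP[].
  have WP : W \subset P by apply/subsetP=> K; rewrite inE => /andP[].
  have [|| e eS0 eW] := conn0 W WP.
  + have [v vX] := set0Pn _ X0; apply/set0Pn; exists (pblock P v).
    by rewrite -XW //; apply: subsetP vX.
  + apply: contraNneq XN => WE; rewrite eqEsubset XA /=; apply/subsetP=> v vA.
    by rewrite XW // WE inP.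
  exists e; first by rewrite inE eS0.
  by have [sA tA] := BA e (subsetP S0B e eS0); rewrite !XW.
- have S01 : S0 :&: S1 = set0.
    apply/setP=> e; rewrite [in RHS]in_set0; apply/negP; rewrite inE => /andP[/(subsetP SB0)].
    by rewrite !inE => /andP[_ /negbTE ->] /and3P[].
  rewrite cardsU S01 cards0 subn0.
  have -> : #|S1| = \sum_(K in P) #|(F K).1|.
    have -> : #|S1| = #|[set e in S1 | ps e \in P]|.
      apply: eq_card => e; rewrite [RHS]inE; case: (boolP (e \in S1)) => //=.
      by rewrite inE => /andP[/BA[sA _] _]; rewrite /ps /= inP.
    rewrite -sum_indegree; apply: eq_bigr => K KP; apply: eq_card => e; rewrite [LHS]inE.
    apply/andP/idP => [[]|eF]; first by rewrite inE => /and3P[_ _ eF] /eqP <-.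
    by rewrite (FS1 e K) //; have [_ -> _] := FB e K KP eF; rewrite eqxx.
  rewrite (card_partition PA) [RHS](eq_bigr (fun K => #|(F K).1| + 1)); last first.
    by move=> K KP; have [_ _ cF _ _] := FP K KP; rewrite -cF addn1.
  by rewrite big_split /= sum1_card -cS0; clear; lia.
- move=> e eB; rewrite /phi; case: ifP => [eB0|]; first by have [] := hdP e eB0.
  rewrite inE eB /= => /negbFE/eqP eq_st; have [sA tA] := BA e eB.
  have [_ _ _ phiK _] := FP _ (inP _ sA); apply: phiK.
  by rewrite inE eB mem_pblock cP sA /= eq_st mem_pblock cP.
move=> v vA; set K := pblock P v; have KP : K \in P := inP v vA.
have vK : v \in K by rewrite mem_pblock cP.
have [_ _ _ phiK parK] := FP K KP.
have -> : indegree phi (B :\: (S0 :|: S1)) v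
    = c v + indegree (F K).2 (inner s t B K :\: (F K).1) v.
  rewrite /indegree -(cardsID B0); congr (_ + _); apply: eq_card => e.
    rewrite !inE /phi inE; case: (boolP (e \in B)) => //=; rewrite ?andbF // => eB.
    case: eqVneq => /=; rewrite ?andbF // => _; rewrite orbF andbT.
    by [].
  rewrite !inE /phi inE; case: (boolP (e \in B)) => //=; rewrite ?andbF // => eB.
  have [sA tA] := BA e eB.
  have sK := inK _ _ sA KP; have tK := inK _ _ tA KP; rewrite sK tK.
  case: eqVneq => /= [eq_st|neq_st]; last first.
    by case: eqVneq => [eqK|]; rewrite ?andbF //= -eqK eq_sym (negbTE neq_st) ?andbF.
  have eS0 : e \notin S0 by apply/negP=> /(subsetP SB0); rewrite inE eq_st eqxx andbF.
  rewrite (negbTE eS0) /= -eq_st andbb.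
  case: (eqVneq (pblock P (s e)) K) => [eqK|neqK]; first by rewrite /ps /= eqK andbT.
  rewrite andbF; apply/negP=> /andP[_ /eqP eqv].
  have [_ _ _ phiK' _] := FP _ (inP _ sA).
  have eI : e \in inner s t B (pblock P (s e)) by rewrite inE eB mem_pblock cP sA /= eq_st mem_pblock cP.
  have := phiK' e eI; rewrite -/(ps e) eqv !inE => /orP[]/eqP vs; move: neqK; rewrite /K vs ?eqxx //.
  by rewrite eq_st eqxx.
by rewrite oddD parK // /w1 addbCA addbb addbF.
Qed.

(* Nebesky's theorem on upper embeddable graphs, in the form of the parity orientation theorem of
   Frank, Jordan and Szigeti. Slacks are even, so when only the trivial partition is tight an edge may
   be committed to either of its ends. Otherwise a finest tight partition prescribes how many co-tree
   edges each part receives from outside, and each part is solved separately. *)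
Theorem parity_tree A B w : A != set0 -> (forall e, e \in B -> s e \in A /\ t e \in A) ->
  loads_fit s t A B w -> has_parity_tree s t A B w.
Proof.
elim/ltn_ind: {A B}(#|A| + #|B|) {-2}A {-2}B (erefl (#|A| + #|B|)) w => n IH A B cn w A0 BA fit.
pose tight (P : {set {set V}}) :=
  [&& partition P A, 1 < #|P| & \sum_(K in P) load s t B w K == #|B|.+1].
case: (boolP [exists P, tight P]) => [/existsP[P0 tP0]|/existsPn loose].
  case: (@arg_maxnP _ P0 tight (fun P => #|P|) tP0) => P /and3P[PA cardP /eqP tP] maxP.
  apply: (parity_tree_glue A0 BA fit PA cardP tP) => [Q QA cPQ|A' B' w' A'0 lt fit'].
    apply/eqP=> tQ; have := maxP Q; rewrite /tight QA tQ eqxx (ltn_trans cardP cPQ) => /(_ isT).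
    by move=> /(leq_trans cPQ); rewrite ltnn.
  by rewrite cn in lt; exact: (IH _ lt _ _ (erefl _)).
apply: parity_tree_loose cn _ => // [P PA cP|B' w' lt]; first by have := loose P; rewrite /tight PA cP.
exact: (IH _ lt _ _ (erefl _)).
Qed.

End ParityTreeTheorem.

(** * Permutations and the genus inequality *)

Section Permutations.
Variable T : finType.
Implicit Types (p q s t : {perm T}) (X Y Z D : {set T}) (x y : T).

Definition stable p X := forall x, (p x \in X) = (x \in X).

Lemma stableC p X : stable p X -> stable p (~: X).
Proof. by move=> sX x; rewrite !inE sX. Qed.

Lemma stableI p X Y : stable p X -> stable p Y -> stable p (X :&: Y).
Proof. by move=> sX sY x; rewrite !inE sX sY. Qed.

Lemma stableU p X Y : stable p X -> stable p Y -> stable p (X :|: Y).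
Proof. by move=> sX sY x; rewrite !inE sX sY. Qed.

Lemma stableM p q X : stable p X -> stable q X -> stable (p * q) X.
Proof. by move=> sp sq x; rewrite permM sq sp. Qed.

Lemma stable_porbit p x : stable p (porbit p x).
Proof. by move=> y; rewrite -!eq_porbit_mem (porbit_perm p 1 y : porbit p (p y) = _). Qed.

Lemma stable_expg p X i x : stable p X -> ((p ^+ i)%g x \in X) = (x \in X).
Proof.
move=> sX; elim: i => [|i IH]; first by rewrite perm1.
by rewrite expgSr permM sX.
Qed.

Lemma porbit_stable p X x y : stable p X -> y \in porbit p x -> (y \in X) = (x \in X).
Proof. by move=> sX /porbitP[i ->]; rewrite stable_expg. Qed.

Lemma stable_porbits p X : (forall x y, y \in porbit p x -> x \in X -> y \in X) -> stable p X.
Proof.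
move=> H x; apply/idP/idP; apply: H; last exact: (mem_porbit p 1 x).
by rewrite porbit_sym (mem_porbit p 1 x).
Qed.

Lemma porbit_sub p X x : x \in X -> {in X, forall y, p y \in X} -> porbit p x \subset X.
Proof.
move=> xX sX; apply/subsetP=> _ /porbitP[i ->].
by elim: i => [|i IH]; rewrite ?perm1 // expgSr permM sX.
Qed.

Lemma partition_porbits p X : stable p X -> partition (porbit p @: X) X.
Proof.
move=> sX; apply/and3P; split.
- apply/eqP/setP=> y; apply/bigcupP/idP => [[_ /imsetP[x xX ->]]|yX].
    by move/(porbit_stable sX) => ->.
  by exists (porbit p y); rewrite ?porbit_id ?imset_f.
- apply/trivIsetP=> _ _ /imsetP[x _ ->] /imsetP[y _ ->] neq.
  apply/pred0P=> z /=; apply/negP=> /andP[]; rewrite -!eq_porbit_mem => /eqP zx /eqP zy.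
  by rewrite -zx zy eqxx in neq.
by apply/imsetP=> -[x _ x0]; have := porbit_id p x; rewrite -x0 in_set0.
Qed.

Lemma porbitsT p : porbits p = porbit p @: setT.
Proof. by apply/setP=> Z; apply/imsetP/imsetP => -[x _ ->]; exists x. Qed.

Lemma card_porbits_split p X : stable p X ->
  #|porbits p| = #|porbit p @: X| + #|porbit p @: ~: X|.
Proof.
move=> sX; have I0 : (porbit p @: X) :&: (porbit p @: ~: X) = set0.
  apply/setP=> Z; rewrite in_set0 inE; apply/negP=> /andP[/imsetP[x xX ->] /imsetP[y yX]].
  move/eqP; rewrite eq_porbit_mem => /(porbit_stable (stableC sX)).
  by rewrite yX inE xX.
by rewrite porbitsT -cardsUI I0 cards0 addn0 -imsetU setUCr.
Qed.

Lemma card_porbit_uniform p X k : stable p X -> {in X, forall x, #|porbit p x| = k} ->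
  #|X| = #|porbit p @: X| * k.
Proof.
move=> sX uX; apply: card_uniform_partition (partition_porbits sX) => _ /imsetP[x xX ->].
exact: uX.
Qed.

Lemma card_porbit1 p x : p x = x -> #|porbit p x| = 1.
Proof.
move=> px; apply/eqP/cards1P; exists x; apply/eqP; rewrite eqEsubset sub1set porbit_id andbT.
by apply: porbit_sub => [|y]; rewrite ?inE // => /eqP ->; rewrite px.
Qed.

Lemma porbit2E p x : p (p x) = x -> porbit p x = [set x; p x].
Proof.
move=> ppx; apply/eqP; rewrite eqEsubset; apply/andP; split.
  apply: porbit_sub => [|y]; rewrite !inE ?eqxx // => /orP[] /eqP ->; rewrite ?ppx ?eqxx ?orbT //.
by apply/subsetP=> y; rewrite !inE => /orP[] /eqP ->; rewrite ?porbit_id ?(mem_porbit p 1 x).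
Qed.

Lemma card_porbit2 p x : p (p x) = x -> p x != x -> #|porbit p x| = 2.
Proof. by move=> ppx px; rewrite porbit2E // cards2 eq_sym px. Qed.

Lemma porbit3E p x : p (p (p x)) = x -> porbit p x = [set x; p x; p (p x)].
Proof.
move=> pppx; apply/eqP; rewrite eqEsubset; apply/andP; split.
  apply: porbit_sub => [|y]; rewrite !inE ?eqxx // => /orP[/orP[]|] /eqP ->; rewrite ?pppx ?eqxx ?orbT //.
apply/subsetP=> y; rewrite !inE => /orP[/orP[]|] /eqP ->; rewrite ?porbit_id ?(mem_porbit p 1 x) //.
by have := mem_porbit p 2 x; rewrite permM.
Qed.

Lemma card_porbit3 p x : p (p (p x)) = x -> p x != x -> #|porbit p x| = 3.
Proof.
move=> pppx px; rewrite porbit3E // setUC cardsU1 cards2 !inE negb_or.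
have -> : (p (p x) == p x) = (p x == x) by rewrite (inj_eq perm_inj).
have -> : (p (p x) == x) = (p x == x).
  by rewrite -(inj_eq (@perm_inj _ p)) pppx eq_sym.
by rewrite px eq_sym px.
Qed.

Lemma restriction p X : stable p X ->
  {q : {perm T} | forall x, q x = if x \in X then p x else x}.
Proof.
move=> sX; have inj_q : injective (fun x => if x \in X then p x else x).
  move=> x y /=; case: ifP => xX; case: ifP => yX; last by [].
  - exact: perm_inj.
  - by move=> pxy; rewrite -pxy sX xX in yX.
  - by move=> pxy; rewrite pxy sX yX in xX.
by exists (perm inj_q) => x; rewrite permE.
Qed.

(** [q] has |X| / k orbits inside [X] and fixes every other point; the count is multiplied by [k] to
    avoid division. *)
Lemma card_porbits_restriction p q X k : stable p X ->
    (forall x, q x = if x \in X then p x else x) -> {in X, forall x, #|porbit p x| = k} ->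
  #|porbits q| * k + #|X| * k = #|T| * k + #|X|.
Proof.
move=> sX qE uX; have sqX : stable q X by move=> x; rewrite qE; case: ifP => // xX; rewrite sX.
have eqo x : x \in X -> porbit q x = porbit p x.
  move=> xX; apply/setP=> y; apply/porbitP/porbitP => -[i ->]; exists i.
    by elim: i => [|i IH]; rewrite ?perm1 // !expgSr !permM IH qE stable_expg // xX.
  by elim: i => [|i IH]; rewrite ?perm1 // !expgSr !permM -IH qE stable_expg // xX.
rewrite (card_porbits_split sqX) (_ : porbit q @: X = porbit p @: X); last first.
  by apply: eq_in_imset.
have := card_porbit_uniform sX uX.
have u1 : {in ~: X, forall x, #|porbit q x| = 1}.
  by move=> x; rewrite inE => xX; apply: card_porbit1; rewrite qE (negbTE xX).
have := card_porbit_uniform (stableC sqX) u1; have := cardsC X.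
rewrite muln1 => <- <- eqX; rewrite {2 3}eqX; lia.
Qed.

(** Says that [D] meets every orbit of the group generated by [s] and [t]; for a connected map one
    point suffices. *)
Definition dominates D s t := forall Z, D \subset Z -> stable s Z -> stable t Z -> Z = [set: T].

Lemma stable_tperm x y Z : (x \in Z) = (y \in Z) -> stable (tperm x y) Z.
Proof. by move=> xy z; case: tpermP => [->|->|]. Qed.

(* The genus of a map is nonnegative. The proof splits [t] into transpositions; one that joins two
   cycles of [t * s] costs at most one more element in a dominating set. *)
Lemma genus_inequality D s t : dominates D s t ->
  #|porbits s| + #|porbits t| + #|porbits (t * s)| <= #|T| + #|D|.*2.
Proof.
have cardO p : #|porbits p| <= #|T| by rewrite /porbits leq_imset_card.
elim/ltn_ind: {t}(#|T| - #|porbits t|) {-2}t (erefl (#|T| - #|porbits t|)) D => n IH t ct D domD.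
case: (pickP (fun x => t x != x)) => [x tx|t1]; last first.
  have {}t1 : t = 1%g by apply/permP=> x; rewrite perm1; apply/eqP; have := t1 x => /negbFE.
  have sD : #|porbits s| <= #|D|.
    have oD : porbits s = porbit s @: D.
      have ZT : [set x | porbit s x \in porbit s @: D] = [set: T].
        apply: domD.
        - by apply/subsetP=> x xD; rewrite inE imset_f.
        - by move=> x; rewrite !inE (porbit_perm s 1 x : porbit s (s x) = _).
        - by move=> x; rewrite t1 perm1.
      apply/setP=> Z; apply/imsetP/imsetP => [[x _ ->]|[x xD ->]]; last by exists x.
      by have := in_setT x; rewrite -ZT inE => /imsetP.
    by rewrite oD leq_imset_card.
  by rewrite t1 mul1g; have := cardO 1%g; move: sD; clear; lia.
pose y := t x; pose t' := (tperm x y * t)%g.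
have tt' : t = (tperm x y * t')%g by rewrite /t' mulgA tperm2 mul1g.
have nxy : x != y by rewrite eq_sym.
have zt : #|porbits t'| = #|porbits t| + 1.
  have := porbits_mul_tperm t x y; rewrite /= -/t' nxy.
  have -> : x \in porbit t y by rewrite porbit_sym (mem_porbit t 1 x).
  by rewrite addn0.
have lt : #|T| - #|porbits t'| < n by rewrite -ct; have := cardO t'; move: zt; clear; lia.
have /= zts := porbits_mul_tperm (t' * s)%g x y.
rewrite mulgA -tt' nxy in zts.
(* If [x] and [y] share a cycle of the product, the transposition splits it, which makes up for the
   cycle lost by [t], and [D] still dominates. Otherwise two cycles are lost in total, and one more
   point in [D] pays for them. *)
case: (boolP (x \in porbit (t' * s) y)) zts => xy /= zts.
  have domD' : dominates D s t'.
    move=> Z DZ sZ tZ; apply: domD => //; rewrite tt'; apply: stableM => //.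
    by apply: stable_tperm; apply: porbit_stable xy; apply: stableM.
  apply: leq_trans (IH _ lt t' (erefl _) D domD').
  by move: zts; rewrite addn0 zt => ->; rewrite -!addnA [1 + _]addnC.
(* One of [x] and [y] works. If both failed, there would be proper invariant sets, one with [x] but
   not [y], one with [y] but not [x]; their intersection contains [D] and is invariant under the
   transposition too, hence is everything. *)
have : exists z, dominates (z |: D) s t'.
  pose bad z Z := [&& z |: D \subset Z, [forall u, (s u \in Z) == (u \in Z)],
     [forall u, (t' u \in Z) == (u \in Z)] & Z != setT].
  have good z : ~~ [exists Z, bad z Z] -> dominates (z |: D) s t'.
    move=> /existsPn noZ Z DZ sZ tZ; have := noZ Z; rewrite /bad DZ /=.
    have -> : [forall u, (s u \in Z) == (u \in Z)] by apply/forallP=> u; rewrite sZ.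
    have -> : [forall u, (t' u \in Z) == (u \in Z)] by apply/forallP=> u; rewrite tZ.
    by move/negbNE/eqP.
  case: (boolP [exists Z, bad x Z]) => [/existsP[Z1 /and4P[D1 s1 t1 T1]]|/good]; last by exists x.
  case: (boolP [exists Z, bad y Z]) => [/existsP[Z2 /and4P[D2 s2 t2 T2]]|/good]; last by exists y.
  have {}s1 : stable s Z1 by move=> u; apply/eqP/(forallP s1).
  have {}s2 : stable s Z2 by move=> u; apply/eqP/(forallP s2).
  have {}t1 : stable t' Z1 by move=> u; apply/eqP/(forallP t1).
  have {}t2 : stable t' Z2 by move=> u; apply/eqP/(forallP t2).
  move: D1 D2; rewrite !subUset !sub1set => /andP[x1 D1] /andP[y2 D2].
  have y1 : y \notin Z1.
    apply/negP=> y1; case/eqP: T1; apply: domD => //; rewrite tt'; apply: stableM => //.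
    by apply: stable_tperm; rewrite x1 y1.
  have x2 : x \notin Z2.
    apply/negP=> x2; case/eqP: T2; apply: domD => //; rewrite tt'; apply: stableM => //.
    by apply: stable_tperm; rewrite x2 y2.
  have : Z1 :&: Z2 = setT.
    apply: domD; first by rewrite subsetI D1.
      exact: stableI.
    rewrite tt'; apply: stableM; last exact: stableI.
    by apply: stable_tperm; rewrite !inE (negbTE y1) (negbTE x2) andbF.
  by move/setP/(_ x); rewrite !inE (negbTE x2) andbF.
case=> z domz; have := IH _ lt t' (erefl _) _ domz; rewrite cardsU1 zt.
have : (z \notin D : nat) <= 1 by case: (_ \notin _).
move: #|porbits (t * s)| #|porbits (t' * s)| zts (z \notin D : nat) #|porbits s| #|porbits t| #|T| #|D|.
by clear=> a b /= zts c d e f g; lia.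
Qed.

End Permutations.

(** * Eulerian triangulations *)

Section Triangulation.
Variables (T : finType) (f h t : {perm T}) (c : T -> bool).
Implicit Types (X Y Z S : {set T}) (x y : T).

Definition boundary X := [set x in X | h x \notin X].
Definition interior X := [set x in X | h x \in X].

(* [S] and [Z] are unions of vertices, i.e. of orbits of [f]; deleting the fewer than 4 vertices of [S]
   leaves no proper nonempty part [Z] that is closed under adjacency. *)
Definition four_connected := 4 < #|porbits f| /\
  forall S Z, stable f S -> stable f Z -> #|porbit f @: S| < 4 -> Z \subset ~: S ->
    (forall x, x \in Z -> h x \notin S -> h x \in Z) -> Z != set0 -> Z = ~: S.

Record eulerian_triangulation : Prop := EulerianTriangulation {
  edge_involutive : forall x, h (h x) = x;
  face_edge : forall x, f (t x) = h x;
  face_cubic : forall x, t (t (t x)) = x;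
  face_free : forall x, t x != x;
  color_vertex : forall x, c (f x) = ~~ c x;
  color_edge : forall x, c (h x) = ~~ c x;
  map_connected : forall Z, stable f Z -> stable h Z -> Z != set0 -> Z = setT;
  (* V - E + F = 2, with E = #|T| / 2 and F = #|T| / 3. *)
  euler_formula : 6 * #|porbits f| = #|T| + 12;
  map_four_connected : four_connected
}.

Hypothesis H : eulerian_triangulation.
Let hK := edge_involutive H.
Let ft := face_edge H.
Let ttt := face_cubic H.
Let cf := color_vertex H.
Let ch := color_edge H.

Lemma vertex_faceV x : f^-1%g (h x) = t x.
Proof. by rewrite -ft permK. Qed.

Lemma face_of_edge x : t (h (f x)) = x.
Proof. by rewrite -vertex_faceV hK permK. Qed.

Lemma color_face x : c (t x) = c x.
Proof. by apply: negb_inj; rewrite -cf ft ch. Qed.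

Lemma edge_free x : h x != x.
Proof. by apply/eqP=> hx; have := ch x; rewrite hx; case: (c x). Qed.

Lemma stable_faces_edges X : stable t X -> stable h X -> stable f X.
Proof. by move=> tX hX x; rewrite -{2}(face_of_edge x) tX hX. Qed.

Lemma card_face x : #|porbit t x| = 3.
Proof. by apply: card_porbit3; rewrite ?ttt //; apply: face_free. Qed.

Lemma card_faces X : stable t X -> #|X| = #|porbit t @: X| * 3.
Proof. by move=> sX; apply: card_porbit_uniform => // x _; apply: card_face. Qed.

Lemma card_all_faces : #|porbits t| * 3 = #|T|.
Proof. by rewrite porbitsT -card_faces ?cardsT // => x; rewrite !inE. Qed.

Lemma color_face_porbit x y : y \in porbit t x -> c y = c x.
Proof. by case/porbitP=> i ->; elim: i => [|i IH]; rewrite ?perm1 // expgSr permM color_face. Qed.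

Lemma card_interior_boundary X : #|X| = #|boundary X| + #|interior X|.
Proof.
rewrite -cardsUI (_ : _ :&: _ = set0) ?cards0 ?addn0; last first.
  by apply/setP=> x; rewrite in_set0 !inE; case: (h x \in X); rewrite ?andbF.
by apply: eq_card => x; rewrite !inE -andb_orr orNb andbT.
Qed.

Lemma stable_interior X : stable h (interior X).
Proof. by move=> x; rewrite !inE hK andbC. Qed.

Lemma boundaryC X : #|boundary (~: X)| = #|boundary X|.
Proof.
rewrite -(card_imset (boundary X) (@perm_inj _ h)); apply: eq_card => x.
apply/idP/imsetP => [|[y]].
  by rewrite !inE negbK => /andP[xX hX]; exists (h x); rewrite ?hK // !inE hX hK.
by rewrite !inE => /andP[yX hX] ->; rewrite hK hX negbK.
Qed.

Definition faces_connected X := forall Y, stable t Y -> Y \subset X ->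
  (forall x, x \in Y -> h x \in X -> h x \in Y) -> Y = set0 \/ Y = X.

(* Deleting from the map the edges interior to [X] does not disconnect it, and it merges all the faces
   of [X]; so the genus inequality says that the faces of [X] form a tree. *)
Lemma interior_of_tree X : stable t X -> X != set0 -> faces_connected (~: X) ->
    (forall x, ~~ (porbit f x \subset X)) ->
  #|interior X| + 6 <= (#|boundary X|).*2.
Proof.
move=> tX X0 conn noint.
have sI := stableC (@stable_interior X).
(* [h'] fixes the darts of the deleted edges, those interior to [X]. *)
have [h' h'E] := restriction sI.
have h'out x : x \notin X -> h' x = h x.
  by move=> xX; rewrite h'E !inE (negbTE xX).
have sX' : stable (h' * f^-1) (~: X).
  have sub x : x \in ~: X -> (h' * f^-1)%g x = t x.
    by rewrite inE => xX; rewrite permM h'out // vertex_faceV.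
  have cX' : {in ~: X, forall x, (h' * f^-1)%g x \in ~: X}.
    by move=> x xX; rewrite sub // (stableC tX).
  apply: stable_porbits => x y yx xX.
  by have /subsetP := porbit_sub xX cX'; apply.
have eqO x : x \in ~: X -> porbit (h' * f^-1) x = porbit t x.
  move=> xX; have E i : ((h' * f^-1) ^+ i)%g x = (t ^+ i)%g x.
    elim: i => [|i IH]; rewrite ?perm1 // !expgSr [LHS]permM IH [RHS]permM [LHS]permM.
    have : (t ^+ i)%g x \in ~: X by rewrite (stable_expg _ _ (stableC tX)).
    by rewrite inE => txX; rewrite h'out // vertex_faceV.
  by apply/setP=> y; apply/porbitP/porbitP => -[i ->]; exists i; rewrite E.
have [x0 x0X] := set0Pn _ X0.
have dom : dominates [set x0] f^-1 h'.
  move=> Z; rewrite sub1set => x0Z fZ hZ.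
  have {}fZ : stable f Z by move=> x; rewrite -(fZ (f x)) permK.
  have tZ x : x \notin X -> (t x \in Z) = (x \in Z).
    by move=> xX; rewrite -(hZ x) h'out // -ft fZ.
  have meets x : exists2 y, y \in ~: X & (y \in Z) = (x \in Z).
    have /subsetPn[y yx yX] := noint x; exists y; first by rewrite inE.
    exact: porbit_stable fZ yx.
  have [|||Z0|ZX] := conn (Z :&: ~: X).
  - move=> x; rewrite !inE (tX x); case: (boolP (x \in X)); rewrite ?andbF //.
    by move=> xX; rewrite tZ.
  - exact: subsetIr.
  - by move=> x; rewrite !inE => /andP[xZ xX] ->; rewrite -(h'out x xX) hZ xZ.
  - have [y yX yZ] := meets x0; have := in_set0 y; rewrite -Z0 inE yX andbT yZ x0Z //.
  - apply/setP=> x; rewrite inE; have [y yX <-] := meets x.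
    by move: yX; rewrite -ZX inE => /andP[].
have zh : #|porbits h'| * 2 + #|~: interior X| * 2 = #|T| * 2 + #|~: interior X|.
  apply: (card_porbits_restriction sI h'E) => x _.
  by apply: card_porbit2; rewrite ?edge_free ?hK.
(* The triangles outside [X] survive as faces, and [X] yields at least one more. *)
have zX' : #|porbits (h' * f^-1)| * 3 >= #|~: X| + 3.
  have -> : #|~: X| = #|porbit (h' * f^-1) @: ~: X| * 3.
    apply: card_porbit_uniform sX' _ => x xX; rewrite eqO //; exact: card_face.
  rewrite (card_porbits_split sX') setCK.
  have : 0 < #|porbit (h' * f^-1) @: X| by rewrite card_gt0; apply/set0Pn; exists (porbit (h' * f^-1) x0); apply: imset_f.
  by move: #|_| #|_|; clear; lia.
have := genus_inequality dom; rewrite cards1 porbitsV.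
have := cardsC X; have := cardsC (interior X); have := card_interior_boundary X.
have := euler_formula H; move: zh zX'.
move: #|~: interior X| #|interior X| #|boundary X| #|~: X| #|X| #|T| #|porbits f| #|porbits h'| #|porbits (h' * f^-1)|.
by clear; lia.
Qed.

End Triangulation.

(** * Small edge cuts of the dual graph *)

Section Cuts.
Variables (T : finType) (f h t : {perm T}) (c : T -> bool).
Implicit Types (X Y Z S : {set T}) (x y : T).
Hypothesis H : eulerian_triangulation f h t c.
Let hK := edge_involutive H.
Let ft := face_edge H.
Let cf := color_vertex H.
Let ch := color_edge H.
Local Notation boundary := (boundary h).
Local Notation interior := (interior h).

Lemma boundary_neq0 X : stable t X -> X != set0 -> X != setT -> 0 < #|boundary X|.
Proof.
move=> tX X0 XT; rewrite card_gt0; apply: contraNneq XT => bd0.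
have hX1 x : x \in X -> h x \in X.
  by move=> xX; apply: contraT => hX; have := in_set0 x; rewrite -bd0 inE xX hX.
have hX : stable h X by move=> x; apply/idP/idP => /hX1 //; rewrite hK.
by apply/eqP/(map_connected H) => //; apply: (stable_faces_edges H).
Qed.

(* A vertex incident with faces inside and outside [X] contributes a boundary edge. *)
Lemma four_connected_side X : stable t X -> #|boundary X| < 4 ->
  (forall x, ~~ (porbit f x \subset X)) \/ (forall x, ~~ (porbit f x \subset ~: X)).
Proof.
move=> tX bd4.
pose S := [set x | ~~ (porbit f x \subset X) && ~~ (porbit f x \subset ~: X)].
pose Z := [set x | porbit f x \subset X].
have of_ x : porbit f (f x) = porbit f x := porbit_perm f 1 x.
have fS : stable f S by move=> x; rewrite !inE of_.
have fZ : stable f Z by move=> x; rewrite !inE of_.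
have [Z0|Z0] := eqVneq Z set0.
  by left=> x; apply/negP=> xZ; have := in_set0 x; rewrite -Z0 inE xZ.
right=> x; apply/negP=> xX.
have ZS : Z = ~: S.
  apply: (map_four_connected H).2 => //.
  - apply: leq_ltn_trans bd4; apply: leq_trans (leq_imset_card (porbit f) (boundary X)).
    apply: subset_leq_card; apply/subsetP=> _ /imsetP[y yS ->].
    (* Around a vertex with corners on both sides, some corner [z] in [X] is preceded by one outside
       [X]. Since f^-1 z = t (h z), this [z] is a boundary dart. *)
    have [] := boolP [forall z in porbit f y :&: X, f^-1%g z \in X].
      move/forall_inP=> all_in; move: yS; rewrite inE => /andP[/negP yX /subsetPn[z zy]].
      rewrite inE negbK => zX; case: yX; rewrite -(eqP (_ : porbit f z == porbit f y)) ?eq_porbit_mem //.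
      have : porbit f^-1 z \subset porbit f y :&: X.
        apply: porbit_sub => [|u uX]; first by rewrite inE zy.
        rewrite inE all_in // andbT; move: uX; rewrite inE => /andP[uy _].
        by rewrite -(stable_porbit f y) permKV.
      by rewrite porbitV subsetI => /andP[].
    rewrite negb_forall_in => /exists_inP[z]; rewrite inE => /andP[zy zX] fz.
    apply/imsetP; exists z; last by apply/eqP; rewrite eq_sym eq_porbit_mem.
    by rewrite inE zX -(tX (h z)) -(vertex_faceV H) hK.
  - by apply/subsetP=> y; rewrite !inE => ->.
  - move=> y; rewrite !inE -negb_or => yX; rewrite negbK => /orP[//|/subsetP hyX].
    have /hyX : t y \in porbit f (h y) by rewrite -ft porbit_sym (mem_porbit f 1 (t y)).
    by rewrite inE tX (subsetP yX) // porbit_id.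
have : x \notin S by rewrite inE xX andbF.
rewrite -in_setC -ZS inE => /subsetP/(_ x (porbit_id f x)) xinX.
by have /subsetP/(_ x (porbit_id f x)) := xX; rewrite inE xinX.
Qed.

(** In a cut of at most 3 edges both sides are connected, since a disconnected side would split it
    into two smaller nonempty cuts. A side containing no whole vertex then satisfies |interior| + 6
    <= 2 |boundary| <= 6, so it has no interior edge and is one triangle. *)
Lemma small_cut X : stable t X -> X != set0 -> X != setT ->
  2 < #|boundary X| /\ (#|boundary X| = 3 -> #|X| = 3 \/ #|~: X| = 3).
Proof.
elim/ltn_ind: {X}#|boundary X| {-2}X (erefl #|boundary X|) => n IH X bdX tX X0 XT.
have [n3|n4] := leqP n 3; last first.
  by rewrite bdX; split; [exact: ltnW | move=> n3; rewrite n3 in n4].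
have conn Y : stable t Y -> #|boundary Y| = n -> faces_connected h t Y.
  move=> tY bdY W tW WY stepW.
  have [->|W0] := eqVneq W set0; first by left.
  have [->|WneqY] := eqVneq W Y; first by right.
  pose W' := Y :\: W.
  have tW' : stable t W' by move=> x; rewrite !inE tW tY.
  have W'0 : W' != set0 by apply: contra WneqY; rewrite setD_eq0 eqEsubset WY.
  have bdU : boundary Y = boundary W :|: boundary W'.
    apply/setP=> x; rewrite !inE; case: (boolP (x \in W)) => xW /=; rewrite ?orbF.
      rewrite (subsetP WY _ xW) /=; apply/idP/idP; last by apply: contra; exact: stepW.
      by apply: contra => /(subsetP WY).
    case: (boolP (x \in Y)) => //= xY; case: (boolP (h x \in Y)) => hxY; last by rewrite andbF.
    rewrite andbT negbK; apply/esym/negbTE; apply: contra xW => hxW.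
    by rewrite -(hK x); apply: stepW; rewrite ?hK.
  have bdI : boundary W :&: boundary W' = set0.
    by apply/setP=> x; rewrite in_set0 !inE; case: (x \in W); rewrite ?andbF.
  have cbd : #|boundary W| + #|boundary W'| = n by rewrite -bdY bdU -cardsUI bdI cards0 addn0.
  have WT : W != setT by apply: contraNneq WneqY => W1; rewrite eqEsubset WY W1 subsetT.
  have W'T : W' != setT.
    apply: contraNneq W0 => W1; rewrite -subset0; apply/subsetP=> x xW.
    by have := in_setT x; rewrite -W1 inE xW.
  have bW := boundary_neq0 tW W0 WT; have bW' := boundary_neq0 tW' W'0 W'T.
  have [] := IH #|boundary W| _ W (erefl _) tW W0 WT; first by rewrite -cbd -{1}[#|boundary W|]addn0 ltn_add2l.
  have [] := IH #|boundary W'| _ W' (erefl _) tW' W'0 W'T; first by rewrite -cbd -{1}[#|boundary W'|]add0n ltn_add2r.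
  by move: n3 cbd; move: #|boundary W| #|boundary W'|; clear; lia.
have tXC := stableC tX.
have XC0 : ~: X != set0 by apply: contra XT => /eqP XC; rewrite -(setCK X) XC setC0.
have bdXC : #|boundary (~: X)| = n by rewrite (boundaryC H) bdX.
have tree Y : stable t Y -> Y != set0 -> #|boundary Y| = n -> faces_connected h t (~: Y) ->
    (forall x, ~~ (porbit f x \subset Y)) -> n = 3 /\ #|Y| = 3.
  move=> tY Y0 bdY cY noY; have := interior_of_tree H tY Y0 cY noY.
  have := card_interior_boundary h Y; rewrite bdY.
  by move: n3; move: #|Y| #|interior Y|; clear; lia.
have bd4 : #|boundary X| < 4 by rewrite bdX.
have [noX|noX] := four_connected_side tX bd4.
  by rewrite bdX; have [-> cX] := tree X tX X0 bdX (conn _ tXC bdXC) noX; split=> // _; left.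
have cX : faces_connected h t (~: (~: X)) by rewrite setCK; exact: conn.
by rewrite bdX; have [-> cXC] := tree _ tXC XC0 bdXC cX noX; split=> // _; right.
Qed.

Lemma card_T_gt : 18 <= #|T|.
Proof. by have [] := map_four_connected H; have := euler_formula H; lia. Qed.

(** Two triangles sharing two edges would have a cut of at most 6 - 4 = 2 edges. *)
Lemma no_double_edge x y : y \in porbit t x -> h y \in porbit t (h x) -> y = x.
Proof.
move=> yx hyhx; apply/eqP; apply: contraT => neq.
pose X := porbit t x :|: porbit t (h x).
have tX : stable t X by apply: stableU; exact: stable_porbit.
have cX : #|X| <= 6 by rewrite cardsU !(card_face H) leq_subr.
have X0 : X != set0 by apply/set0Pn; exists x; rewrite inE porbit_id.
have XT : X != setT.
  by apply: contraTneq cX => ->; rewrite cardsT -ltnNge; apply: leq_trans card_T_gt.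
have [+ _] := small_cut tX X0 XT.
have : 4 <= #|interior X|.
  have sub : [set x; y] :|: [set h x; h y] \subset interior X.
    by apply/subsetP=> z; rewrite !inE => /orP[] /orP[] /eqP ->;
       rewrite ?hK ?porbit_id ?yx ?hyhx ?orbT.
  apply: leq_trans (subset_leq_card sub).
  rewrite cardsU !cards2 (inj_eq perm_inj) eq_sym neq (eqP (_ : _ :&: _ == set0)) ?cards0 //.
  rewrite setI_eq0; apply/pred0P=> z; apply/negP=> /andP[].
  rewrite !inE => zxy zhxy; have cz : c z = c x.
    by case/orP: zxy => /eqP -> //; exact: color_face_porbit H _ _ yx.
  have : c z = ~~ c x.
    by case/orP: zhxy => /eqP ->; rewrite ch ?(color_face_porbit H yx).
  by rewrite cz; case: (c x).
have := card_interior_boundary h X; move: cX.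
by move: #|boundary X| #|interior X| #|X|; clear; lia.
Qed.

(** Otherwise the triangle at the corner [f x] would share with the triangle of [x] both edges at
    this vertex. *)
Lemma opposite_corners x : f (f x) \notin porbit t x.
Proof.
apply/negP=> ffx; have thf := face_of_edge H.
have o1 y : y \in porbit t (t y) by rewrite porbit_sym (mem_porbit t 1 y).
have e1 : h (f (f x)) \in porbit t (f x).
  by have := o1 (h (f (f x))); rewrite thf.
have e2 : h (h (f (f x))) \in porbit t (h (f x)).
  have : x \in porbit t (h (f x)) by rewrite -{1}(thf x) (mem_porbit t 1 (h (f x))).
  by rewrite -eq_porbit_mem hK -!eq_porbit_mem => /eqP <-; rewrite eq_porbit_mem.
have eq_hf := no_double_edge e1 e2.
have := thf (f x); rewrite eq_hf => tfx; have := face_free H (f x).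
by rewrite tfx eqxx.
Qed.

End Cuts.

Lemma even_indegree_bound (V E : finType) (phi : E -> V) (C : {set E}) (I : {set V}) :
    {in I, forall v, indegree phi C v != 0 /\ ~~ odd (indegree phi C v)} ->
  #|I| * 2 <= #|C|.
Proof.
move=> even_deg; rewrite -sum_nat_const.
apply: leq_trans (_ : \sum_(v in I) indegree phi C v <= _).
  apply: leq_sum => v /even_deg[]; by case: (indegree phi C v) => [|[]].
by rewrite sum_indegree; apply: subset_leq_card; apply/subsetP=> e; rewrite inE => /andP[].
Qed.

(** * Flipping triangles to obtain a single cycle *)

Section SingleCycle.
Variables (T : finType) (f h t : {perm T}) (c : T -> bool).
Implicit Types (X Y Z S W : {set T}) (x y : T).
Hypothesis H : eulerian_triangulation f h t c.
Let hK := edge_involutive H.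
Let ttt := face_cubic H.
Let ch := color_edge H.

Definition single_cycle (p : {perm T}) := forall x y, y \in porbit p x.

Lemma single_cycle_leq1 p : #|porbits p| <= 1 -> single_cycle p.
Proof.
move=> /card_le1_eqP cyc x y; rewrite -eq_porbit_mem; apply/eqP; apply: cyc; exact: imset_f.
Qed.

(* [E] is a spanning tree of the dual of the map with vertices [f'] and faces [psi], so the other
   edges connect the vertices. Since each of them lies on a face of [Y], flipping the faces of [Y] glues
   all the vertices together. *)
Lemma flip_single_cycle (f' psi : {perm T}) Y E :
    (forall x, f' (psi x) = h x) -> stable t Y -> {in Y, forall x, f' (t x) = h x} ->
    stable h E -> #|E| + 2 = #|porbits psi| * 2 ->
    (forall Z, stable psi Z -> {in E, forall x, x \in Z -> h x \in Z} -> Z != set0 -> Z = setT) ->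
    (forall x, x \notin E -> (x \in Y) || (h x \in Y)) ->
    2 * #|Y| + 3 <= 3 * #|porbits f'| ->
  exists2 p : {perm T}, (forall x, p x = if x \in Y then h x else f' x) & single_cycle p.
Proof.
move=> fpsi tY fY hE cE connE coverY cY.
have [tYp tYE] := restriction tY.
have [hEp hEE] := restriction hE.
exists (tYp * f')%g => [x|]; first by rewrite permM tYE; case: ifP => // /fY.
move=> x0; have dom1 : dominates [set x0] psi hEp.
  move=> Z; rewrite sub1set => x0Z pZ hZ; apply: connE => // [x xE xZ|]; last by apply/set0Pn; exists x0.
  by have := hZ x; rewrite hEE xE xZ.
(* Walking around a spanning tree traverses its whole neighbourhood once: the faces joined along the
   tree edges become one. *)
have z1 : #|porbits (hEp * psi)| <= 1.
  have := genus_inequality dom1; rewrite cards1.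
  have := card_porbits_restriction hE hEE (k := 2).
  have u2 : {in E, forall x, #|porbit h x| = 2}.
    by move=> x _; apply: card_porbit2; rewrite ?(edge_free H) ?hK.
  move=> /(_ u2); move: cE.
  by move: #|E| #|porbits psi| #|porbits hEp| #|porbits (hEp * psi)| #|T|; clear; lia.
have cyc1 := single_cycle_leq1 z1.
have dom2 : dominates [set x0] f' tYp.
  move=> Z; rewrite sub1set => x0Z fZ tZ.
  have hZY x : x \in Y -> (h x \in Z) = (x \in Z).
    by move=> xY; rewrite -fY // fZ; have := tZ x; rewrite tYE xY.
  have hZ x : x \notin E -> (h x \in Z) = (x \in Z).
    by move=> /coverY/orP[/hZY //|/hZY]; rewrite hK.
  have sZ : stable (hEp * psi) Z.
    move=> x; rewrite permM -fZ fpsi hEE; case: (boolP (x \in E)) => [|/hZ //].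
    by rewrite hK.
  by apply/setP=> y; rewrite inE (porbit_stable sZ (cyc1 x0 y)).
apply: single_cycle_leq1.
have := genus_inequality dom2; rewrite cards1.
have := card_porbits_restriction tY tYE (k := 3).
move=> /(_ (fun x _ => card_face H x)); move: cY.
by move: #|Y| #|porbits f'| #|porbits tYp| #|porbits (tYp * f')| #|T|; clear; lia.
Qed.

Lemma half_color W : stable h W -> #|[set x in W | c x]| * 2 = #|W|.
Proof.
move=> hW; rewrite -[in RHS](cardsID [set x | c x]) muln2 -addnn; congr (_ + _).
  by apply: eq_card => x; rewrite !inE.
rewrite -(card_imset _ (@perm_inj _ h)); apply: eq_card => x; apply/imsetP/idP => [[y]|].
  by rewrite !inE => /andP[yW cy] ->; rewrite ch cy hW.
by rewrite !inE => /andP[cx xW]; exists (h x); rewrite ?hK // !inE hW xW ch cx.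
Qed.

(** With 3k = 2i + |boundary|, a cut of at least 4 edges leaves room for the parity bit, and a cut
    of 3 requires the bit to vanish. It does for a single triangle; for the complement of one it
    does when the number of vertices is odd. *)
Lemma load_bound W i k : stable t W -> W != set0 -> W != setT -> #|W| = 3 * k ->
    i * 2 = #|interior h W| -> (#|~: W| == 3) ==> odd #|porbits f| ->
  (i + odd (i + k + 1) + 1) * 2 <= 3 * k.
Proof.
move=> tW W0 WT cW ci exc; have [bd3 bd3'] := small_cut H tW W0 WT.
have cib := card_interior_boundary h W.
have [bdW|bd4] := eqVneq #|boundary h W| 3; last first.
  have : 3 < #|boundary h W| by rewrite ltn_neqAle eq_sym bd4.
  move: cib; rewrite -ci cW; move: #|boundary h W| => bd; have := leq_b1 (odd (i + k + 1)).
  by move: (odd (i + k + 1) : nat) => b; clear; lia.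
case: (bd3' bdW) => [W3|WC3].
  have [-> ->] : k = 1 /\ i = 0 by move: cib cW ci; rewrite W3 bdW; clear; lia.
  by [].
have := cardsC W; have := euler_formula H; rewrite WC3 cW => eul cT.
rewrite WC3 eqxx /= in exc.
(* With 2m + 1 vertices there are 4m - 2 triangles, so k = 4m - 3, i = 6m - 6, and i + k + 1 = 10m -
   8 is even. *)
have [m mE] : exists m, #|porbits f| = m.*2.+1.
  by exists #|porbits f|./2; rewrite -[LHS]odd_double_half exc.
have [V4 _] := map_four_connected H.
have kE : k = 4 * m - 3 by move: eul cT; rewrite mE; clear; lia.
have iE : i = 6 * m - 6 by move: eul cT cib cW ci bdW kE; rewrite mE; clear; lia.
have m2 : 1 < m by move: V4; rewrite mE; clear; lia.
have -> : i + k + 1 = (5 * m - 4).*2 by rewrite iE kE; move: m2; clear; lia.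
by rewrite odd_double kE iE; move: m2; clear; lia.
Qed.

End SingleCycle.

(** * Triangulations with an odd number of vertices *)

Section OddCase.
Variables (T : finType) (f h t : {perm T}) (c : T -> bool).
Implicit Types (X Y Z S W : {set T}) (x y : T).
Hypothesis H : eulerian_triangulation f h t c.
Let hK := edge_involutive H.
Let ft := face_edge H.
Let cf := color_vertex H.
Let ch := color_edge H.

Lemma card_inner (V : finType) (rho : T -> V) (B0 : {set T}) (X : {set V}) : stable h B0 ->
  #|inner rho (rho \o h) [set x in B0 | c x] X| * 2 = #|B0 :&: interior h (rho @^-1: X)|.
Proof.
move=> hB; rewrite -[RHS](half_color H); last by apply: stableI => //; exact: stable_interior H _.
by congr (_ * 2); apply: eq_card => x; rewrite !inE andbAC.
Qed.

Definition both_darts S := [set x | (x \in S) || (h x \in S)].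

Lemma stable_both_darts S : stable h (both_darts S).
Proof. by move=> x; rewrite !inE hK orbC. Qed.

Lemma card_both_darts S : {in S, forall x, c x} -> #|both_darts S| = #|S| * 2.
Proof.
move=> cS; rewrite -(half_color H (@stable_both_darts S)); congr (_ * 2).
apply: eq_card => x; rewrite !inE; apply/andP/idP => [[]|xS]; last by rewrite xS cS.
by case/orP=> // /cS; rewrite ch; case: (c x).
Qed.

Lemma card_faces_in (X : {set {set T}}) : X \subset porbits t -> #|porbit t @^-1: X| = 3 * #|X|.
Proof.
move=> XA; have sX : stable t (porbit t @^-1: X).
  by move=> x; rewrite !inE (porbit_perm t 1 x : porbit t (t x) = _).
rewrite (card_faces H sX) mulnC; congr (3 * _); apply: eq_card => Z.
apply/imsetP/idP => [[x]|ZX]; first by rewrite inE => + ->.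
have /imsetP[x _ Zx] := subsetP XA Z ZX; by exists x; rewrite // inE -Zx.
Qed.

(** The dual edges are represented by their darts of colour true, one for each edge. Twice the loads
    sum to at most the number of darts, 2|B|; only the one-block partition, whose cut is empty,
    needs the extra 2. *)
Lemma loads_fit_odd_order : odd #|porbits f| ->
  loads_fit (porbit t) (porbit t \o h) (porbits t) [set x | c x] (fun=> false).
Proof.
move=> oddV P PA.
have hT : stable h setT by move=> x; rewrite !inE.
have BT : [set x | c x] = [set x in setT | c x] by apply/setP=> x; rewrite !inE.
have cB : #|[set x | c x]| * 2 = #|T| by rewrite BT (half_color H hT) cardsT.
have cN : #|porbits t| * 3 = #|T| by rewrite (card_all_faces H).
have hatT : porbit t @^-1: porbits t = setT by apply/setP=> x; rewrite !inE imset_f.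
have inner2 (X : {set {set T}}) : #|inner (porbit t) (porbit t \o h) [set x | c x] X| * 2
    = #|interior h (porbit t @^-1: X)|.
  by rewrite BT card_inner // setTI.
have eul := euler_formula H; have [V4 _] := map_four_connected H.
have ld (X : {set {set T}}) : X \in P -> load (porbit t) (porbit t \o h) [set x | c x] (fun=> false) X * 2 <= 3 * #|X| + (X == porbits t).*2.
  move=> XP; have XA := partitionS PA XP; have cX := card_faces_in XA; have iX := inner2 X.
  rewrite /load /parity_bit big1 ?addn0 //.
  have [XE|XnA] := eqVneq X (porbits t).
    rewrite XE hatT in iX; have intT : interior h setT = setT by apply/setP=> x; rewrite !inE.
    rewrite intT cardsT in iX; rewrite XE.
    have [m mE] : exists m, #|porbits f| = m.*2.+1.
      by exists #|porbits f|./2; rewrite -[LHS]odd_double_half oddV.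
    have -> : #|inner (porbit t) (porbit t \o h) [set x | c x] (porbits t)| + #|porbits t| + 1 = (5 * m - 2).*2.
      by move: eul V4 iX cN; rewrite mE; clear; lia.
    by rewrite odd_double addn0 mulnDl iX -cN mulnC.
  rewrite addn0; apply: (load_bound H (W := porbit t @^-1: X)) => //.
  - by move=> x; rewrite !inE (porbit_perm t 1 x : porbit t (t x) = _).
  - by rewrite -card_gt0 cX muln_gt0 card_gt0 (partition_neq0 PA XP).
  - apply: contra XnA => /eqP hX; rewrite eqEsubset XA; apply/subsetP=> _ /imsetP[x _ ->].
    by have := in_setT x; rewrite -hX inE.
  - by rewrite oddV implybT.
have : \sum_(X in P) load (porbit t) (porbit t \o h) [set x | c x] (fun=> false) X * 2
     <= \sum_(X in P) (3 * #|X| + (X == porbits t).*2) by exact: leq_sum.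
rewrite -big_distrl /= [X in _ <= X]big_split /= -big_distrr /= -(card_partition PA).
have : \sum_(X in P) (X == porbits t).*2 <= 2.
  case: (boolP (porbits t \in P)) => [AP|AP].
    by rewrite (bigD1 (porbits t)) //= eqxx big1 // => X /andP[_ /negbTE ->].
  by rewrite big1 // => X XP; case: eqVneq => // XA; rewrite -XA XP in AP.
move=> le2 /leq_trans/(_ (leq_add (leqnn _) le2)).
by rewrite mulnC [3 * _]mulnC cN -cB mulnC addnC -mulSn leq_pmul2r.
Qed.

Theorem odd_order_single_cycle : odd #|porbits f| ->
  exists2 p : {perm T}, (forall x, p x \in [set f x; f^-1%g x; h x]) & single_cycle p.
Proof.
move=> oddV; set B := [set x | c x].
have hT : stable h setT by move=> x; rewrite !inE.
have BT : B = [set x in setT | c x] by apply/setP=> x; rewrite !inE.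
have cB : #|B| * 2 = #|T| by rewrite BT (half_color H hT) cardsT.
have cN : #|porbits t| * 3 = #|T| by rewrite (card_all_faces H).
have eul := euler_formula H; have [V4 _] := map_four_connected H.
have A0 : porbits t != set0 by rewrite -card_gt0; move: eul V4 cN; clear; lia.
have BA e : e \in B -> porbit t e \in porbits t /\ (porbit t \o h) e \in porbits t.
  by move=> _; rewrite /= !imset_f.
have [S [phi [SB conn cS ends par]]] := parity_tree A0 BA (loads_fit_odd_order oddV).
pose deg v := indegree phi (B :\: S) v.
pose Y := [set x | deg (porbit t x) != 0].
have tY : stable t Y by move=> x; rewrite !inE (porbit_perm t 1 x : porbit t (t x) = _).
have [||||||p pE cyc] := @flip_single_cycle _ _ _ _ _ H f t Y (both_darts S) ft tY.
- by move=> x _; exact: ft.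
- exact: stable_both_darts.
- rewrite card_both_darts -?cS; first by clear; lia.
  by move=> x /(subsetP SB); rewrite inE.
- move=> Z tZ hZ Z0; apply/eqP; apply: contraT => ZT.
  have memZ x : (porbit t x \in porbit t @: Z) = (x \in Z).
    apply/imsetP/idP => [[y yZ]|]; last by exists x.
    by move/eqP; rewrite eq_porbit_mem => /(porbit_stable tZ) ->.
  have [||| e eS] := conn (porbit t @: Z).
  + by apply/subsetP=> _ /imsetP[x _ ->]; exact: imset_f.
  + by have [x xZ] := set0Pn _ Z0; apply/set0Pn; exists (porbit t x); exact: imset_f.
  + apply: contra ZT => /eqP ZA; apply/eqP/setP=> x; rewrite inE -memZ ZA; exact: imset_f.
  have eE : e \in both_darts S by rewrite inE eS.
  have heE : h e \in both_darts S by rewrite stable_both_darts.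
  rewrite /= !memZ; have := hZ e eE; have := hZ (h e) heE; rewrite hK.
  case: (e \in Z); case: (h e \in Z) => //.
- move=> x; rewrite inE negb_or => /andP[xS hxS].
  have covered y : c y -> y \notin S -> (y \in Y) || (h y \in Y).
    move=> cy yS; have yC : y \in B :\: S by rewrite !inE yS.
    have : deg (phi y) != 0 by rewrite -lt0n card_gt0; apply/set0Pn; exists y; rewrite inE yC eqxx.
    have := ends y; rewrite inE cy => /(_ isT); rewrite !inE.
    by case/orP=> /eqP -> ->; rewrite ?orbT.
  by case: (boolP (c x)) => cx; [exact: covered | rewrite orbC -{2}(hK x); apply: covered; rewrite ?ch].
(* By Euler's formula the co-tree has one edge fewer than there are vertices, and each triangle of
   [Y] absorbs at least two. *)
- have YI : #|Y| = #|porbit t @: Y| * 3 by exact: (card_faces H).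
  have := @even_indegree_bound _ _ phi (B :\: S) (porbit t @: Y).
  have -> : #|B :\: S| = #|B| - #|S| by rewrite cardsD (setIidPr SB).
  have degY : {in porbit t @: Y, forall v, indegree phi (B :\: S) v != 0 /\ ~~ odd (indegree phi (B :\: S) v)}.
    by move=> _ /imsetP[x xY ->]; rewrite par ?imset_f //; move: xY; rewrite inE.
  by move=> /(_ degY); move: eul V4 cN cB cS YI; clear; lia.
exists p => // x; rewrite pE !inE; case: ifP; rewrite ?eqxx ?orbT //.
Qed.

End OddCase.

(** * Triangulations with an even number of vertices *)

Section EvenCase.
Variables (T : finType) (f h t : {perm T}) (c : T -> bool).
Implicit Types (Y Z S W : {set T}) (x y : T) (X P : {set {set T}}).
Hypothesis H : eulerian_triangulation f h t c.
Let hK := edge_involutive H.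
Let ft := face_edge H.
Let ttt := face_cubic H.
Let cf := color_vertex H.
Let ch := color_edge H.

(** Euler's formula makes the average degree less than 6, colours alternate around a vertex so
    degrees are even, and degree 2 is excluded by [opposite_corners]. *)
Lemma ex_degree_four : exists x, f (f (f (f x))) = x /\ c x = false.
Proof.
suff [x fx] : exists x, f (f (f (f x))) = x.
  by case cx: (c x); [exists (f x); rewrite fx cf cx | exists x].
case: (boolP [forall x, 6 <= #|porbit f x|]) => [/forallP ge6|].
  have cT : #|T| = \sum_(O in porbits f) #|O|.
    by rewrite porbitsT -cardsT; apply/card_partition/partition_porbits => x; rewrite !inE.
  have : \sum_(O in porbits f) 6 <= #|T|.
    by rewrite cT; apply: leq_sum => _ /imsetP[x _ ->]; exact: ge6.
  by rewrite sum_nat_const; have := euler_formula H; lia.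
rewrite negb_forall => /existsP[x]; rewrite -ltnNge => lt6; exists x.
have itx := iter_porbit f x; have := card_porbit_neq0 f x.
have ffx : f (f x) != x by apply: contraNneq (opposite_corners H x) => ->; exact: porbit_id.
have odd_iter k y : c (iter k f y) = c y (+) odd k.
  by elim: k => [|k IH] /=; rewrite ?addbF // cf IH addbN.
have := odd_iter #|porbit f x| x; rewrite itx.
move: lt6 itx; case: #|porbit f x| => [|[|[|[|[|[|k]]]]]] //= _ itx; case: (c x) => // _ _.
all: by rewrite itx eqxx in ffx.
Qed.

Section DegreeFour.
Variable x1 : T.
Let x2 := f x1.
Let x3 := f x2.
Let x4 := f x3.
Hypotheses (fx4 : f x4 = x1) (cx1 : c x1 = false).

Let cx2 : c x2. Proof. by rewrite cf cx1. Qed.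
Let cx3 : c x3 = false. Proof. by rewrite cf cx2. Qed.
Let cx4 : c x4. Proof. by rewrite cf cx3. Qed.
Let thx2 : t (h x2) = x1. Proof. exact: face_of_edge H x1. Qed.
Let thx3 : t (h x3) = x2. Proof. exact: face_of_edge H x2. Qed.
Let thx4 : t (h x4) = x3. Proof. exact: face_of_edge H x3. Qed.
Let thx1 : t (h x1) = x4. Proof. by rewrite -fx4; exact: face_of_edge H x4. Qed.

(* The triangles at the vertex x1 are the [t]-orbits of x1, x2, x3, x4. In the reduced dual graph the
   2nd and 4th, with corner set [R], are deleted, and the 1st and 3rd are identified as [tau]. *)
Let R := porbit t x2 :|: porbit t x4.
Let tau := porbit t x1.
Let rho x := if x \in porbit t x3 then tau else porbit t x.
Let removed := [set porbit t x2; porbit t x3; porbit t x4].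
Let A := porbits t :\: removed.
Let B0 := ~: both_darts h R.
Let B := [set x in B0 | c x].

Let tR : stable t R. Proof. by apply: stableU; exact: stable_porbit. Qed.

Let cR : {in R, forall x, c x}.
Proof. by move=> x; rewrite inE => /orP[] /(color_face_porbit H) ->. Qed.

Let x31 : x3 \notin porbit t x1. Proof. exact: opposite_corners H x1. Qed.
Let x42 : x4 \notin porbit t x2. Proof. exact: opposite_corners H x2. Qed.

Let color_neq x y : c x != c y -> x \notin porbit t y.
Proof. by apply: contraNN => /(color_face_porbit H) ->. Qed.

Let x1R : x1 \notin R. Proof. by apply/negP=> /cR; rewrite cx1. Qed.
Let x3R : x3 \notin R. Proof. by apply/negP=> /cR; rewrite cx3. Qed.

Let porbit_t x : porbit t (t x) = porbit t x := porbit_perm t 1 x.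

Let cardR : #|R| = 6.
Proof.
have I0 : porbit t x2 :&: porbit t x4 = set0.
  apply/setP=> x; rewrite in_set0 inE; apply/negP=> /andP[].
  rewrite -!eq_porbit_mem => /eqP e2 /eqP e4; move: x42.
  by rewrite -eq_porbit_mem -e4 e2 eqxx.
by rewrite cardsU !(card_face H) I0 cards0.
Qed.

Let cardA : #|A| + 3 = #|porbits t|.
Proof.
have subA : removed \subset porbits t.
  by apply/subsetP=> _ /setUP[/setUP[]|] /set1P ->; exact: imset_f.
rewrite /A cardsDS // -{2}(subnK (subset_leq_card subA)); congr (_ + _).
rewrite /removed setUC cardsU1 cards2 !inE !eq_porbit_mem.
have x43 : x4 \notin porbit t x3 by apply: color_neq; rewrite cx4 cx3.
have x23 : x2 \notin porbit t x3 by apply: color_neq; rewrite cx2 cx3.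
by rewrite (negbTE x42) (negbTE x43) x23.
Qed.

Let cardB : #|B| * 2 + 12 = #|T|.
Proof.
rewrite (half_color H); last by apply: stableC; exact: stable_both_darts H _.
by rewrite -(cardsC (both_darts h R)) (card_both_darts H cR) cardR addnC.
Qed.

Let B0P x : x \in B0 -> x \notin R /\ h x \notin R.
Proof. by rewrite !inE !negb_or => /andP[/andP[-> ->] /andP[-> ->]]. Qed.

Let rhoA x : x \notin R -> rho x \in A.
Proof.
move=> xR; rewrite /rho; case: (boolP (x \in porbit t x3)) => x3x; rewrite !inE imset_f // andbT.
  have x12 : x1 \notin porbit t x2 by apply: color_neq; rewrite cx1 cx2.
  have x14 : x1 \notin porbit t x4 by apply: color_neq; rewrite cx1 cx4.
  by rewrite /tau !eq_porbit_mem (negbTE x12) (negbTE x14) orbF porbit_sym x31.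
by move: xR x3x; rewrite !inE !eq_porbit_mem !negb_or => /andP[-> ->] ->.
Qed.

Let rho_t x : rho (t x) = rho x.
Proof. by rewrite /rho stable_porbit porbit_t. Qed.

Let rho_out x X : X \subset A -> tau \notin X -> (rho x \in X) = (porbit t x \in X).
Proof.
move=> XA tX; rewrite /rho; case: ifP => // xx3; rewrite (negbTE tX); apply/esym/negbTE.
apply/negP=> /(subsetP XA); rewrite in_setD => /andP[nr _]; case/negP: nr.
by apply/setUP; left; apply/setUP; right; rewrite inE eq_porbit_mem.
Qed.

Let loadX X := load rho (rho \o h) B (fun=> false) X.

Let loadXE X : X != set0 -> loadX X =
  #|inner rho (rho \o h) B X| + odd (#|inner rho (rho \o h) B X| + #|X| + 1) + 1.
Proof. by move=> X0; rewrite /loadX /load /parity_bit big1 ?addn0. Qed.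

Let inner2 X : #|inner rho (rho \o h) B X| * 2 = #|B0 :&: interior h (rho @^-1: X)|.
Proof. by rewrite (card_inner H) //; apply: stableC; exact: stable_both_darts H _. Qed.

(** The complement contains the two deleted triangles, so it is not a single triangle and the parity
    condition of [load_bound] is void. *)
Let load_out X : X != set0 -> X \subset A -> tau \notin X -> loadX X * 2 <= 3 * #|X|.
Proof.
move=> X0 XA tX; rewrite loadXE //.
have XP : X \subset porbits t by apply: subset_trans XA (subsetDl _ _).
have XR x : porbit t x \in X -> x \notin R.
  move=> /(subsetP XA); rewrite in_setD => /andP[+ _]; apply: contra.
  by rewrite !inE => /orP[]; rewrite -eq_porbit_mem => ->; rewrite ?orbT.
apply: (load_bound H (W := porbit t @^-1: X)).
- by move=> x; rewrite !inE porbit_t.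
- by rewrite -card_gt0 (card_faces_in H) // muln_gt0 card_gt0 X0.
- by apply/eqP=> XT; have := in_setT x1; rewrite -XT inE (negbTE tX).
- exact: (card_faces_in H).
- rewrite inner2; apply: eq_card => x; rewrite in_setI !inE !rho_out //.
  case: (boolP (porbit t x \in X)); rewrite ?andbF //= => /XR; rewrite inE => /negbTE ->.
  by case: (boolP (porbit t (h x) \in X)); rewrite ?andbF //= => /XR; rewrite inE => /negbTE ->.
have subC : R \subset ~: (porbit t @^-1: X).
  by apply/subsetP=> x xR; rewrite !inE; apply: contraL xR => /XR.
have := subset_leq_card subC; rewrite cardR; case: eqVneq => // ->.
by [].
Qed.

(** The three missing triangles are put back. They add 9 darts, of which at least 8 become interior
    together with their partners on the first triangle; a cut of at least 3 edges then gives 2i <=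
    3|X| - 2, enough even if the parity bit is 1. *)
Let load_in X : X \subset A -> X != A -> tau \in X -> loadX X * 2 <= 3 * #|X| + 2.
Proof.
move=> XA XnA tX; rewrite loadXE; last by apply/set0Pn; exists tau.
have remP : removed \subset porbits t.
  by apply/subsetP=> _ /setUP[/setUP[]|] /set1P ->; exact: imset_f.
pose W := porbit t @^-1: (X :|: removed).
have XP : X :|: removed \subset porbits t.
  by rewrite subUset remP andbT; apply: subset_trans XA (subsetDl _ _).
have disj : X :&: removed = set0.
  apply/setP=> Z; rewrite in_set0 in_setI; apply/negP=> /andP[/(subsetP XA)].
  by rewrite in_setD => /andP[/negbTE ->].
have cW : #|W| = 3 * (#|X| + 3).
  rewrite (card_faces_in H) // cardsU disj cards0 subn0; congr (3 * (_ + _)).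
  by apply/eqP; rewrite -(eqn_add2l #|A|) cardA cardsDS // subnK // subset_leq_card.
have tW : stable t W by move=> x; rewrite !inE porbit_t.
have rhoW x : rho x \in X -> x \in W.
  rewrite /rho [x \in W]inE in_setU; case: ifP => [xx3 _|_ ->//].
  by apply/orP; right; apply/setUP; left; apply/setUP; right; rewrite inE eq_porbit_mem.
have RW x : x \in R -> x \in W.
  rewrite [x \in R]inE [x \in W]inE in_setU => /orP[] xR; apply/orP; right.
    by apply/setUP; left; apply/setUP; left; rewrite inE eq_porbit_mem.
  by apply/setUP; right; rewrite inE eq_porbit_mem.
have x1W : x1 \in W by rewrite inE in_setU tX.
have x3W : x3 \in W.
  by rewrite inE in_setU; apply/orP; right; apply/setUP; left; apply/setUP; right; rewrite inE.
have W0 : W != set0 by apply/set0Pn; exists x1.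
have WT : W != setT.
  apply: contra XnA => /eqP WT; rewrite eqEsubset XA; apply/subsetP=> Z.
  rewrite in_setD => /andP[Zr /imsetP[x _ Zx]].
  have := in_setT x; rewrite -WT inE -Zx in_setU (negbTE Zr) orbF //.
have [bd3 _] := small_cut H tW W0 WT; have cib := card_interior_boundary h W.
(* [t x2] and [t x4] are the sides opposite to the degree-4 vertex; the other four sides of the
   deleted triangles separate them from the 1st and 3rd. *)
pose F := R :\ t x2 :\ t x4.
have cF : 4 <= #|F|.
  have := cardR; rewrite (cardsD1 (t x2) R) (cardsD1 (t x4)) -/F.
  by case: (_ \in _); case: (_ \in _); clear; lia.
have hFW x : x \in F -> h x \in W.
  move=> /setD1P[n4 /setD1P[n2 /setUP[]]]; rewrite porbit3E ?ttt // => /setUP[/set2P[]|/set1P] xE.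
  - by rewrite xE -(tW (h x2)) thx2.
  - by rewrite xE eqxx in n2.
  - by have -> : h x = x3 by rewrite xE -thx3 ttt hK.
  - by rewrite xE -(tW (h x4)) thx4.
  - by rewrite xE eqxx in n4.
  - by have -> : h x = x1 by rewrite xE -thx1 ttt hK.
have FR : {subset F <= R} by move=> x; rewrite !inE => /and3P[_ _].
have cFF : #|both_darts h F| = #|F| * 2 by apply: (card_both_darts H) => x /FR/cR.
have subI : both_darts h F :|: (B0 :&: interior h (rho @^-1: X)) \subset interior h W.
  apply/subsetP=> x /setUP[|/setIP[_]].
    rewrite inE => /orP[xF|hxF]; rewrite inE; first by rewrite RW ?FR // hFW.
    by rewrite -{1}(hK x) hFW // RW // FR.
  by rewrite inE => /andP[]; rewrite inE [h x \in _]inE => /rhoW xW /rhoW hxW; rewrite inE xW hxW.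
have disjI : both_darts h F :&: (B0 :&: interior h (rho @^-1: X)) = set0.
  apply/setP=> x; rewrite in_set0; apply/negP=> /setIP[+ /setIP[/B0P[xR hxR] _]].
  by rewrite inE => /orP[/FR|/FR]; apply/negP.
have := subset_leq_card subI; rewrite cardsU disjI cards0 subn0 cFF -inner2.
move=> le_in; apply: leq_trans (_ : (#|inner rho (rho \o h) B X| + 1 + 1) * 2 <= _).
  by rewrite leq_mul2r leq_add2r leq_add2l leq_b1.
move: le_in cF cW bd3 cib; move: #|inner rho (rho \o h) B X| #|F| #|W| #|interior h W| #|boundary h W| #|X|.
by clear; lia.
Qed.

Hypothesis evenV : ~~ odd #|porbits f|.

Let BA e : e \in B -> rho e \in A /\ (rho \o h) e \in A.
Proof. by rewrite inE => /andP[/B0P[eR heR] _]; rewrite /= !rhoA. Qed.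

Let tauA : tau \in A.
Proof. by have := rhoA x1R; rewrite /rho porbit_sym (negbTE x31). Qed.

(** Summing gives 2 * total <= 3|A| + 2 = 2|B| + 5, so the total is at most |B| + 2. It is odd like
    |A|, while |B| is even, so |B| + 2 is excluded. *)
Let loads_fit_even : loads_fit rho (rho \o h) A B (fun=> false).
Proof.
move=> P PA.
have [m mE] : exists m, #|porbits f| = m.*2.
  by exists #|porbits f|./2; rewrite -[LHS]odd_double_half (negbTE evenV).
have eul := euler_formula H; have [V4 _] := map_four_connected H; have cN := card_all_faces H.
have A_odd : odd #|A|.
  have -> : #|A| = (2 * m - 4).*2.+1 by move: eul V4 cN cardA cardB; rewrite mE; clear; lia.
  by rewrite /= odd_double.
have B_even : odd #|B| = false.
  have -> : #|B| = (3 * m - 6).*2 by move: eul V4 cN cardA cardB; rewrite mE; clear; lia.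
  by rewrite odd_double.
have ld X : X \in P -> loadX X * 2 <= 3 * #|X| + (tau \in X).*2.
  move=> XP; have XA := partitionS PA XP; have X0 := partition_neq0 PA XP.
  have [tX|tX] := boolP (tau \in X); last by rewrite addn0; exact: load_out.
  have [->|XnA] := eqVneq X A; last exact: load_in.
  rewrite loadXE; last by apply/set0Pn; exists tau.
  have leB : #|inner rho (rho \o h) B A| <= #|B|.
    by apply: subset_leq_card; apply/subsetP=> e; rewrite inE => /andP[].
  apply: leq_trans (_ : (#|B| + 1 + 1) * 2 <= _).
    by rewrite leq_mul2r !leq_add ?leq_b1.
  by move: cardA cardB cN; rewrite /=; move: #|A| #|B| #|T| #|porbits t|; clear; lia.
have le_sum : (\sum_(X in P) loadX X) * 2 <= 3 * #|A| + 2.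
  rewrite big_distrl /=; apply: leq_trans (_ : \sum_(X in P) (3 * #|X| + (tau \in X).*2) <= _).
    exact: leq_sum.
  rewrite big_split /= -big_distrr /= -(card_partition PA) leq_add2l.
  have [/eqP cP tP nP] := and3P PA.
  rewrite (bigD1 (pblock P tau)) ?pblock_mem ?cP //= mem_pblock cP tauA /= big1 // => X /andP[XP neq].
  by case: (boolP (tau \in X)) => // /(def_pblock tP XP) eqX; rewrite eqX eqxx in neq.
have odd_sumP : odd (\sum_(X in P) loadX X).
  rewrite (odd_sum_load rho (rho \o h) B (fun=> false) PA).
  by rewrite (eq_bigr (fun=> 1)) // sum1_card.
have : \sum_(X in P) loadX X <= #|B|.+2.
  by move: le_sum; move: (\sum_(X in P) loadX X) => y; move: cardA cardB cN; clear; lia.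
rewrite leq_eqVlt => /orP[/eqP E|//].
by move: odd_sumP; rewrite E /= B_even.
Qed.

Let rep Z x : stable t Z -> (x1 \in Z) = (x3 \in Z) ->
  exists2 y, rho x = porbit t y & (y \in Z) = (x \in Z).
Proof.
move=> tZ Z13; rewrite /rho; case: ifP => [xx3|_]; last by exists x.
by exists x1; rewrite // Z13 (porbit_stable tZ xx3).
Qed.

Let rho_stable Z x y : stable t Z -> (x1 \in Z) = (x3 \in Z) -> rho x = rho y ->
  (x \in Z) = (y \in Z).
Proof.
move=> tZ Z13; have [x' -> <-] := rep x tZ Z13; have [y' -> <-] := rep y tZ Z13.
by move/eqP; rewrite eq_porbit_mem => /(porbit_stable tZ).
Qed.

(** Of the six sides of the 1st and 3rd triangles, four border deleted triangles; only the two
    opposite to the degree-4 vertex remain. *)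
Let rho_tau e : e \in B -> rho e != tau /\ (rho (h e) = tau -> e \in [set h (t x1); h (t x3)]).
Proof.
rewrite inE => /andP[/B0P[eR heR] ce].
have in_tau x : rho x = tau -> x \in porbit t x1 :|: porbit t x3.
  rewrite /rho; case: ifP => [xx3 _|_ /eqP]; rewrite inE; first by rewrite xx3 orbT.
  by rewrite eq_porbit_mem => ->.
split; first by apply: contraTneq ce => /in_tau/setUP[] /(color_face_porbit H) ->; rewrite ?cx1 ?cx3.
move/in_tau/setUP; rewrite !porbit3E ?ttt // => -[] /setUP[/set2P[]|/set1P] hE; apply/set2P.
- by case/negP: eR; rewrite -(hK e) hE -(tR (h x1)) thx1 inE porbit_id orbT.
- by left; rewrite -hE hK.
- by case/negP: eR; rewrite -(hK e) hE -thx2 ttt hK inE porbit_id.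
- by case/negP: eR; rewrite -(hK e) hE -(tR (h x3)) thx3 inE porbit_id.
- by right; rewrite -hE hK.
by case/negP: eR; rewrite -(hK e) hE -thx4 ttt hK inE porbit_id orbT.
Qed.

Let tau_degree S phi : S \subset B -> connected_by rho (rho \o h) A S ->
    (forall e, e \in B -> phi e \in [set rho e; (rho \o h) e]) ->
    ~~ odd (indegree phi (B :\: S) tau) ->
  indegree phi (B :\: S) tau = 0.
Proof.
move=> SB conn ends even_tau.
have tau1A : [set tau] \subset A by rewrite sub1set.
have tau0 : [set tau] != set0 by apply/set0Pn; exists tau; exact: set11.
have tauNA : [set tau] != A.
  apply/eqP=> tA; have := cardA; rewrite -tA cards1.
  by have := card_all_faces H; have := card_T_gt H; clear; lia.
have [e eS] := conn _ tau1A tau0 tauNA; have eB := subsetP SB e eS.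
have [re rhe] := rho_tau eB; rewrite !inE (negbTE re) /=; case: (eqVneq (rho (h e)) tau) => // /rhe e2 _.
have sub : [set x in B :\: S | phi x == tau] \subset [set h (t x1); h (t x3)] :\ e.
  apply/subsetP=> x; rewrite inE => /andP[/setDP[xB xS] /eqP px]; have [rx rhx] := rho_tau xB.
  apply/setD1P; split; first by apply: contraNneq xS => ->.
  have := ends x xB; rewrite px => /set2P[xt|/esym/rhx //]; by rewrite -xt eqxx in rx.
have := subset_leq_card sub; have := cardsD1 e [set h (t x1); h (t x3)].
rewrite e2 cards2; move: even_tau; rewrite /indegree.
case: (_ != _); case: #|[set x in _ | _]| => [|[|k]] //=; clear; lia.
Qed.

Lemma degree_four_single_cycle :
  exists2 p : {perm T}, (forall x, p x \in [set f x; f^-1%g x; h x]) & single_cycle p.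
Proof.
have eul := euler_formula H; have [V4 _] := map_four_connected H; have cN := card_all_faces H.
have A0 : A != set0 by apply/set0Pn; exists tau.
have [S [phi [SB conn cS ends par]]] := parity_tree A0 BA loads_fit_even.
have tau_deg : indegree phi (B :\: S) tau = 0.
  by apply: tau_degree conn ends _ => //; rewrite par.
pose deg v := indegree phi (B :\: S) v.
pose Y1 := [set x | (x \notin R) && (deg (rho x) != 0)].
have tY1 : stable t Y1 by move=> x; rewrite [in LHS]inE [in RHS]inE tR rho_t.
pose Y := R :|: Y1; have tY : stable t Y by apply: stableU.
have notY x : x \notin R -> rho x = tau -> x \notin Y.
  by move=> xR xtau; rewrite in_setU negb_or xR inE xtau /deg tau_deg eqxx andbF.
have x1Y : x1 \notin Y by apply: notY => //; rewrite /rho porbit_sym (negbTE x31).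
have x3Y : x3 \notin Y by apply: notY => //; rewrite /rho porbit_id.
have n31 : x1 != x3 by apply: contraNneq x31 => <-; exact: porbit_id.
(* [f'] splits the 4-cycle of [f] into the 2-cycles (x1 x4) and (x3 x2), and [psi] joins the 1st and
   3rd triangles. *)
pose f' := (tperm x1 x3 * f)%g; pose psi := (t * tperm x1 x3)%g.
have cf' : #|porbits f'| = #|porbits f| + 1.
  have x1f : x1 \in porbit f x3 by have := mem_porbit f 2 x3; rewrite permM [f (f x3)]fx4.
  by have := porbits_mul_tperm f x1 x3; rewrite /= n31 x1f addn0.
have cpsi : #|porbits psi| + 1 = #|porbits t|.
  have := porbits_mul_tperm t^-1 x1 x3; rewrite /= n31 porbitV porbit_sym x31 porbitsV.
  have -> : (tperm x1 x3 * t^-1)%g = psi^-1%g by rewrite invMg tpermV.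
  by rewrite porbitsV; clear; lia.
(* The edges of [x2] and [x4] hang the two deleted triangles back on the merged face as leaves. *)
pose E := both_darts h (x2 |: (x4 |: S)).
have SR x : x \in S -> x \notin R.
  by move/(subsetP SB); rewrite inE => /andP[/B0P[]].
have x2R : x2 \in R by rewrite inE porbit_id.
have x4R : x4 \in R by rewrite inE porbit_id orbT.
have cE : #|E| = (#|S| + 2) * 2.
  rewrite (card_both_darts H) => [|x /setU1P[->//|/setU1P[->//|/(subsetP SB)]]]; last first.
    by rewrite inE => /andP[].
  have n24 : x2 != x4 by apply: contraNneq x42 => <-; exact: porbit_id.
  have x2S : x2 \notin S by apply: contraL x2R => /SR.
  have x4S : x4 \notin S by apply: contraL x4R => /SR.
  by rewrite !cardsU1 !inE negb_or n24 x2S x4S; congr (_ * 2); clear; lia.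
have [||||||||p pE cyc] := @flip_single_cycle _ _ _ _ _ H f' psi Y E.
- by move=> x; rewrite !permM tpermK ft.
- exact: tY.
- move=> x xY; have txY : t x \in Y by rewrite tY.
  by rewrite permM tpermD ?ft //; apply: contraTneq txY => <-.
- exact: stable_both_darts H _.
- by rewrite cE; move: cS cpsi cardA; clear; lia.
- move=> Z psiZ hZ Z0.
  have eZ x : x \in E -> (h x \in Z) = (x \in Z).
    move=> xE; have hxE : h x \in E by rewrite (stable_both_darts H).
    by apply/idP/idP => [/(hZ _ hxE)|/(hZ _ xE)//]; rewrite hK.
  have Z13 : (x1 \in Z) = (x3 \in Z).
    have tx1 : psi x1 = t x1.
      rewrite permM tpermD //; first by rewrite eq_sym (face_free H).
      by apply: contraNneq x31 => ->; exact: (mem_porbit t 1 x1).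
    have ttx1 : psi (t x1) = t (t x1).
      rewrite permM tpermD //.
        by rewrite -{1}(ttt x1) (face_free H).
      by apply: contraNneq x31 => ->; have := mem_porbit t 2 x1; rewrite permM.
    have tttx1 : psi (t (t x1)) = x3 by rewrite permM ttt tpermL.
    by rewrite -tttx1 psiZ -ttx1 psiZ -tx1 psiZ.
  have tZ : stable t Z.
    have -> : t = (psi * tperm x1 x3)%g by rewrite /psi -mulgA tperm2 mulg1.
    by apply: stableM => //; exact: stable_tperm.
  have x2E : x2 \in E by rewrite inE setU11.
  have x4E : x4 \in E by rewrite inE in_setU1 setU11 orbT.
  have Z2 : (x2 \in Z) = (x1 \in Z) by rewrite -(eZ x2) // -tZ thx2.
  have Z4 : (x4 \in Z) = (x1 \in Z) by rewrite -(eZ x4) // -tZ thx4 Z13.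
  have RZ x : x \in R -> (x \in Z) = (x1 \in Z).
    by rewrite inE => /orP[]/(porbit_stable tZ) ->; rewrite ?Z2 ?Z4.
  apply/eqP; apply: contraT => ZT.
  have memZ x : x \notin R -> (rho x \in rho @: (Z :\: R)) = (x \in Z).
    move=> xR; apply/imsetP/idP => [[y /setDP[yZ _]]|xZ]; last by exists x => //; apply/setDP.
    by move/(rho_stable tZ Z13) => ->.
  have [||| e eS] := conn (rho @: (Z :\: R)).
  + by apply/subsetP=> _ /imsetP[x /setDP[_ xR] ->]; exact: rhoA.
  + have [x xZ] := set0Pn _ Z0; apply/set0Pn; case: (boolP (x \in R)) => xR.
      by exists (rho x1); apply: imset_f; apply/setDP; rewrite -(RZ x).
    by exists (rho x); apply: imset_f; apply/setDP.
  + apply: contra ZT => /eqP ZA; apply/eqP/setP=> x; rewrite in_setT.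
    have outZ y : y \notin R -> y \in Z by move=> yR; rewrite -memZ // ZA rhoA.
    by case: (boolP (x \in R)) => [/RZ ->|]; exact: outZ.
  have eE : e \in E by rewrite inE !in_setU1 eS !orbT.
  have := subsetP SB e eS; rewrite inE => /andP[/B0P[eR heR] _].
  by rewrite /= !memZ // eZ // eqxx.
- move=> x xE; have covered y : c y -> y \notin R -> h y \notin R -> y \notin S -> (y \in Y) || (h y \in Y).
    move=> cy yR hyR yS.
    have yB : y \in B by rewrite inE cy andbT !inE !negb_or; move: yR hyR; rewrite !inE !negb_or => -> ->.
    have yC : y \in B :\: S by apply/setDP.
    have degy : deg (phi y) != 0.
      by rewrite -lt0n card_gt0; apply/set0Pn; exists y; rewrite inE yC eqxx.
    have inY1 z : z \notin R -> phi y = rho z -> z \in Y.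
      by move=> zR phiy; rewrite in_setU [z \in Y1]inE zR -phiy degy orbT.
    by case/set2P: (ends y yB) => [/inY1 -> //|/inY1 ->]; rewrite ?orbT.
  case: (boolP (x \in R)) => xR; first by rewrite in_setU xR.
  case: (boolP (h x \in R)) => hxR; first by rewrite [h x \in Y]in_setU hxR orbT.
  move: xE; rewrite inE !in_setU1 !negb_or => /andP[/and3P[_ _ xS] /and3P[_ _ hxS]].
  case: (boolP (c x)) => cx; first exact: covered.
  by rewrite orbC -{2}(hK x); apply: covered; rewrite ?hK // ch cx.
(* With |V| = 2m at most m - 2 triangles lie in [Y1]; with the two in [R] this is m, exactly what 2m
   + 1 vertices allow. *)
- rewrite cf'; have cY1 := card_faces H tY1.
  have := @even_indegree_bound _ _ phi (B :\: S) (porbit t @: Y1).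
  have -> : #|B :\: S| = #|B| - #|S| by rewrite cardsD (setIidPr SB).
  have degY : {in porbit t @: Y1, forall v, indegree phi (B :\: S) v != 0 /\ ~~ odd (indegree phi (B :\: S) v)}.
    move=> _ /imsetP[x + ->]; rewrite inE => /andP[xR]; rewrite /deg => dx.
    have xE : porbit t x = rho x.
      by move: dx; rewrite /rho; case: ifP => // _; rewrite tau_deg.
    by rewrite xE dx par // rhoA.
  move=> /(_ degY) le1; have : #|Y| <= 6 + #|Y1|.
    by rewrite -cardR cardsU leq_subr.
  move: le1 cY1 eul cN cS cardA cardB.
  move: #|Y| #|Y1| #|porbit t @: Y1| #|B| #|S| #|A| #|T| #|porbits t| #|porbits f|.
  by clear; lia.
exists p => // x; rewrite pE; case: ifP => _; first by rewrite !inE eqxx !orbT.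
rewrite permM; case: tpermP => [->|->|_ _].
- have -> : f x3 = f^-1%g x1 by apply: (@perm_inj _ f); rewrite permKV.
  by rewrite !inE eqxx orbT.
- have -> : f x1 = f^-1%g x3 by apply: (@perm_inj _ f); rewrite permKV.
  by rewrite !inE eqxx orbT.
by rewrite !inE eqxx.
Qed.

End DegreeFour.

Theorem even_order_single_cycle : ~~ odd #|porbits f| ->
  exists2 p : {perm T}, (forall x, p x \in [set f x; f^-1%g x; h x]) & single_cycle p.
Proof. by have [x [fx cx]] := ex_degree_four; exact: degree_four_single_cycle fx cx. Qed.

End EvenCase.

(** * From the plane graph to the triangulation *)

Lemma fconnect_porbit (T : finType) (p : {perm T}) x y : fconnect p x y = (y \in porbit p x).
Proof.
apply/idP/porbitP => [xy|[i ->]]; last by rewrite permX fconnect_iter.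
by exists (findex p x y); rewrite permX iter_findex.
Qed.

Lemma perm_subtype (T : finType) (a : pred T) (p : {perm T}) :
  (forall x, a x -> a (p x)) -> exists q : {perm {x | a x}}, forall u, val (q u) = p (val u).
Proof.
move=> ap; have inj_q : injective (fun u : {x | a x} => exist a (p (val u)) (ap _ (valP u))).
  by move=> u v [] /perm_inj/val_inj.
by exists (perm inj_q) => u; rewrite permE.
Qed.

Lemma connect_closed (T : finType) (r : rel T) (P : T -> Prop) x y :
  connect r x y -> P x -> (forall a b, r a b -> P a -> P b) -> P y.
Proof.
move=> /connectP[s rs ->] Px step; elim: s x Px rs => //= z s IH x Px /andP[rxz].
by apply: IH; exact: step rxz Px.
Qed.

Section PlaneGraph.
Variables (D : finType) (n e : {perm D}) (col : D -> 'I_3).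
Hypothesis plane : cubic_plane_graph n e.
Hypothesis proper : proper_face_coloring n e col.
Hypothesis hexagons : forall x, val (col x) != 2 -> fingraph.order (face_perm n e) x = 6.
Hypothesis conn4 : k_connected (contracted_vertices n e col) (contracted_adj n e) 4.
Implicit Types x y z : D.

Let eK x : e (e x) = x. Proof. by have [[]] := plane. Qed.
Let n_order x : uniq [:: x; n x; n (n x)] /\ n (n (n x)) = x.
Proof.
have [_ /(_ x) nx _ _ _] := plane; have := orbit_uniq n x; rewrite /orbit nx; split=> //.
by have := iter_order (@perm_inj _ n) x; rewrite nx.
Qed.
Let nnn x : n (n (n x)) = x. Proof. by have [] := n_order x. Qed.

Let col_n x : col (n x) = col (e x).
Proof. by have [<- _] := proper (e x); rewrite /face_perm eK. Qed.

Let col_neq x : (col x != col (n x)) && (col (n x) != col (n (n x))) && (col (n (n x)) != col x).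
Proof.
have neq y : col y != col (n y) by rewrite col_n eq_sym; have [] := proper y.
by rewrite !neq -{2}(nnn x) neq.
Qed.

Let colours x : [/\ val (col x) < 3, val (col (n x)) < 3, val (col (n (n x))) < 3 &
  [/\ val (col x) <> val (col (n x)), val (col (n x)) <> val (col (n (n x)))
    & val (col (n (n x))) <> val (col x)]].
Proof.
split; try exact: ltn_ord; have /andP[/andP[n1 n2] n3] := col_neq x.
by split=> /val_inj/eqP E; [move: n1 | move: n2 | move: n3]; rewrite E.
Qed.

Local Notation white x := (val (col x) == 2).
Local Notation K := {x | white x}.

Let phi : {perm D} := (e * n)%g.
Let phiE : phi =1 face_perm n e. Proof. by move=> x; rewrite permM. Qed.

Let col_phi x : col (n (e x)) = col x. Proof. by have [] := proper x. Qed.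

Let white_h x : white x -> white (n (n (e (n x)))).
Proof.
have := colours x; have := colours (e (n x)).
have -> : col (n (e (n x))) = col (n x) by exact: col_phi.
by rewrite -col_n; move=> [_ _ H1 [_ H2 H3]] [_ H4 H5 [H6 H7 H8]] /eqP H9; apply/eqP; lia.
Qed.

Let white_t x : white x -> white (e (n (e (n x)))).
Proof.
move=> /white_h; have := col_phi (e (n (e (n x)))); rewrite eK => <-.
by [].
Qed.

Let white_f x : white x -> white (n (e x)). Proof. by rewrite col_phi. Qed.

Let hexagon x : ~~ white x -> iter 6 (face_perm n e) x = x /\ uniq (traject (face_perm n e) x 6).
Proof.
move=> wx; have inj_phi : injective (face_perm n e) by move=> y z /perm_inj/perm_inj.
have E := hexagons wx; split; first by have := iter_order inj_phi x; rewrite E.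
by have := orbit_uniq (face_perm n e) x; rewrite /orbit E.
Qed.

(** The white dart at the vertex of [x]: the three colours occur once each around a vertex, so
    vertices of G correspond to white darts. *)
Definition corner x := if white x then x else if white (n x) then n x else n (n x).

Let white_corner x : white (corner x).
Proof.
rewrite /corner; case: ifP => // /eqP w1; case: ifP => // /eqP w2.
by have [H1 H2 H3 [H4 H5 H6]] := colours x; apply/eqP; lia.
Qed.

Let corner_n x : corner (n x) = corner x.
Proof.
rewrite /corner nnn; have [H1 H2 H3 [H4 H5 H6]] := colours x.
case: ifP => [/eqP w2|/eqP w2]; first by case: eqP => // w1; lia.
by case: ifP => [/eqP w3|/eqP w3]; case: eqP => // w1; lia.
Qed.

Let corner_white x : white x -> corner x = x. Proof. by rewrite /corner => ->. Qed.

Let corner_porbit x : corner x \in porbit n x.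
Proof.
rewrite porbit3E // !inE /corner; do !case: ifP => _; by rewrite eqxx ?orbT.
Qed.

Let corner_unique x y : white y -> y \in porbit n x -> y = corner x.
Proof.
move=> wy /porbitP[i yE]; rewrite -(corner_white wy) yE.
by elim: i {yE} => [|i IH]; rewrite ?perm1 // expgSr permM corner_n.
Qed.

Let corner_e x : [\/ corner (e x) = n (e (corner x)), n (e (corner (e x))) = corner x
  | corner (e x) = n (n (e (n (corner x))))].
Proof.
case: (boolP (white x)) => wx.
  constructor 1; rewrite (corner_white wx); apply/esym/corner_unique; first exact: white_f.
  exact: (mem_porbit n 1).
case: (boolP (white (n x))) => wnx.
  have we : white (e x) by rewrite -col_n.
  by constructor 2; rewrite (corner_white we) eK -corner_n corner_white.
have cE : corner x = n (n x) by rewrite /corner (negbTE wx) (negbTE wnx).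
constructor 3; rewrite cE nnn; apply/esym/corner_unique.
  by have := white_h (white_corner x); rewrite cE nnn.
by have := mem_porbit n 2 (e x); rewrite permM.
Qed.

Let card_darts : #|D| = 3 * #|[set x | white x]|.
Proof.
set W := [set x | white x].
have sh (p : {perm D}) : #|[set x | p x \in W]| = #|W|.
  rewrite -(card_imset [set x | p x \in W] (@perm_inj _ p)); apply: eq_card => y.
  apply/imsetP/idP => [[x]|yW]; first by rewrite in_set => ? ->.
  by exists ((p^-1)%g y); [rewrite in_set permKV | rewrite permKV].
have sumE (A : {set D}) : \sum_x (x \in A : nat) = #|A|.
  by rewrite -sum1_card [RHS]big_mkcond; apply: eq_bigr => x _; case: (x \in A).
have -> : #|D| = \sum_(x : D) ((x \in W) + (x \in [set y | n y \in W]) + (x \in [set y | (n * n)%g y \in W])).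
  rewrite -sum1_card; apply: eq_bigr => x _; rewrite !inE permM.
  have [+ + + [+ + +]] := colours x; move: (val (col x)) (val (col (n x))) (val (col (n (n x)))).
  by move=> [|[|[|a]]] [|[|[|b]]] [|[|[|d]]].
by rewrite !big_split /= !sumE !sh; clear; lia.
Qed.

Section Rotations.
(** [f] follows the white face. [h] crosses the edge of [n x], the one at this vertex that is not on
    its white face, and [t] makes two steps along the hexagon across the edge of [x]. *)
Variables (f h t : {perm K}).
Hypotheses (fE : forall u, val (f u) = n (e (val u)))
  (hE : forall u, val (h u) = n (n (e (n (val u)))))
  (tE : forall u, val (t u) = e (n (e (n (val u))))).

Let white_at x : K := exist _ (corner x) (white_corner x).

Lemma corner_invariant (Z : {set K}) x : stable f Z -> stable h Z ->
  (corner (e x) \in val @: Z) = (corner x \in val @: Z).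
Proof.
move=> fZ hZ; have memv (u : K) : (val u \in val @: Z) = (u \in Z).
  by apply/imsetP/idP => [[v vZ /val_inj ->]|]; last by exists u.
case: (corner_e x) => [->|<-|->].
- have -> : n (e (corner x)) = val (f (white_at x)) by rewrite fE.
  by rewrite memv fZ -memv.
- have -> : n (e (corner (e x))) = val (f (white_at (e x))) by rewrite fE.
  by rewrite memv fZ -memv.
have -> : n (n (e (n (corner x)))) = val (h (white_at x)) by rewrite hE.
by rewrite memv hZ -memv.
Qed.

Lemma rotations_connected (Z : {set K}) : stable f Z -> stable h Z -> Z != set0 -> Z = setT.
Proof.
move=> fZ hZ /set0Pn[u uZ]; apply/setP=> v; rewrite in_setT.
have memv (w : K) : (val w \in val @: Z) = (w \in Z).
  by apply/imsetP/idP => [[w' wZ /val_inj ->]|]; last by exists w.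
have [_ _ conn _ _] := plane.
have := connect_closed (P := fun x => corner x \in val @: Z) (conn (val u) (val v)).
rewrite (corner_white (valP u)) (corner_white (valP v)) !memv; apply=> //.
by move=> x y /orP[] /eqP ->; rewrite ?corner_n // corner_invariant.
Qed.

Lemma imset_porbit_f u : val @: porbit f u = porbit phi (val u).
Proof.
have itE i : val ((f ^+ i)%g u) = (phi ^+ i)%g (val u).
  by elim: i => [|i IH]; rewrite ?perm1 // !expgSr !permM fE IH.
apply/setP=> x; apply/imsetP/porbitP => [[_ /porbitP[i ->] ->]|[i ->]]; first by exists i.
by exists ((f ^+ i)%g u); [exact: mem_porbit | rewrite itE].
Qed.

Lemma vertices_porbits : vertices n = porbits n.
Proof.
by apply: eq_imset => x; apply/setP=> y; rewrite inE fconnect_porbit.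
Qed.

Lemma face_of_porbit x : face_of n e x = porbit phi x.
Proof.
by apply/setP=> y; rewrite inE -fconnect_porbit; apply: eq_fconnect => z; rewrite phiE.
Qed.

Lemma contracted_porbits : contracted_vertices n e col = (fun O : {set K} => val @: O) @: porbits f.
Proof.
apply/setP=> F; apply/imsetP/imsetP => [[x + ->]|[_ /imsetP[u _ ->] ->]].
  rewrite inE => wx; exists (porbit f (exist _ x wx)); first exact: imset_f.
  by rewrite imset_porbit_f face_of_porbit.
by exists (val u); [rewrite inE; exact: (valP u) | rewrite imset_porbit_f face_of_porbit].
Qed.

Lemma card_contracted : #|contracted_vertices n e col| = #|porbits f|.
Proof. by rewrite contracted_porbits card_imset //; apply: imset_inj; exact: val_inj. Qed.

Lemma card_white : #|[set x | white x]| = #|{: K}|.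
Proof. by rewrite card_sig; apply: eq_card => x; rewrite inE. Qed.

(** G has |K| vertices and 3|K| darts, of which 2|K| lie on hexagons, so there are |K| / 3 hexagons;
    Euler's formula for G becomes the one for H. *)
Lemma euler_rotations : 6 * #|porbits f| = #|{: K}| + 12.
Proof.
have [_ _ _ _] := plane.
have cV : #|vertices n| * 3 = #|D|.
  rewrite vertices_porbits porbitsT -card_porbit_uniform ?cardsT // => [x|x _].
    by rewrite !inE.
  by apply: card_porbit3 => //; have [+ _] := n_order x; rewrite /= !inE eq_sym; case: eqP.
have cF : #|faces n e| = #|porbits f| + #|porbit phi @: ~: [set x | white x]|.
  have -> : faces n e = porbits phi by apply: eq_imset => x; exact: face_of_porbit.
  have sW : stable phi [set x | white x] by move=> x; rewrite !inE permM col_phi.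
  rewrite (card_porbits_split sW) -card_contracted; congr (_ + _); apply: eq_card => F.
  by apply/imsetP/imsetP => -[x xW ->]; exists x => //; rewrite face_of_porbit.
have cH : #|~: [set x | white x]| = #|porbit phi @: ~: [set x | white x]| * 6.
  apply: card_porbit_uniform => [x|x]; first by rewrite !inE permM col_phi.
  rewrite !inE => wx; have [itx uniqx] := hexagon wx.
  rewrite -(hexagons wx) -face_of_porbit /face_of cardsE.
  by apply: eq_card => y; rewrite inE.
have := cardsC [set x | white x]; have := card_darts; rewrite card_white cF => c1 c2 c3.
by move: cV cH c1 c2 c3; move: #|_| #|_| #|_| #|_| #|_| #|_|; clear; lia.
Qed.

Let face (u : K) := porbit phi (val u).

Let face_stable (S : {set K}) u v : stable f S -> face u = face v -> (u \in S) = (v \in S).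
Proof.
move=> fS; rewrite /face -!imset_porbit_f => /(imset_inj val_inj)/eqP.
by rewrite eq_porbit_mem => /(porbit_stable fS).
Qed.

Let incident_face u x : incident n (face u) x -> face (white_at x) = face u.
Proof.
case/existsP=> z /andP[]; rewrite fconnect_porbit => zx zu.
have wz : white z.
  by move: zu; rewrite /face -imset_porbit_f => /imsetP[v _ ->]; exact: (valP v).
by apply/eqP; rewrite eq_porbit_mem /= -(corner_unique wz zx).
Qed.

(** A contracted adjacency comes from an edge of G joining vertices of different white faces; by
    [corner_e] such an edge is crossed by [h], so a set closed under [h] is closed under
    adjacency. *)
Lemma rotations_four_connected : four_connected f h.
Proof.
have [V4 conn] := conn4; split; first by rewrite -card_contracted.
move=> S Z fS fZ cS ZS step /set0Pn[z zZ]; apply/eqP; rewrite eqEsubset ZS /=.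
apply/subsetP=> y yS.
pose S' := face @: S.
have memS u : (face u \in S') = (u \in S).
  apply/imsetP/idP => [[v vS]|]; last by exists u.
  by move/(face_stable fS) ->.
have cS' : #|S'| < 4.
  apply: leq_ltn_trans cS.
  have -> : S' = (fun O : {set K} => val @: O) @: (porbit f @: S).
    by rewrite -imset_comp; apply: eq_imset => u; rewrite /= imset_porbit_f.
  exact: leq_imset_card.
have inV u : u \notin S -> face u \in contracted_vertices n e col :\: S'.
  move=> uS; rewrite inE memS uS contracted_porbits; apply/imsetP.
  by exists (porbit f u); rewrite ?imset_porbit_f // imset_f.
have zS : z \notin S by have := subsetP ZS z zZ; rewrite inE.
have yS' : y \notin S by move: yS; rewrite inE.
have := connect_closed (P := fun F => exists2 u, u \in Z & F = face u) (conn S' cS' _ _ (inV z zS) (inV y yS')).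
case=> [|a b|u uZ /(face_stable fZ) ->//]; first by exists z.
move=> /= /and3P[_ bV /andP[ab /existsP[x /andP[ax bx]]]] [u uZ aE].
have /setDP[] := bV; rewrite contracted_porbits => /imsetP[_ /imsetP[v _ ->] bE] bS.
rewrite imset_porbit_f -/(face v) in bE; rewrite {}aE {}bE in ab ax bx bV bS *.
have au := incident_face ax; have bv := incident_face bx.
have face_f w : face (f w) = face w.
  by rewrite /face fE -(porbit_perm phi 1 (val w)) /= permM.
case: (corner_e x) => cE.
- case/eqP: ab; rewrite -au -bv -(face_f (white_at x)); congr face; apply: val_inj.
  by rewrite /= fE cE.
- case/eqP: ab; rewrite -au -bv -(face_f (white_at (e x))); congr face; apply: val_inj.
  by rewrite /= fE cE.
have hx : white_at (e x) = h (white_at x) by apply: val_inj; rewrite /= hE cE.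
have xZ : white_at x \in Z by rewrite (face_stable fZ au).
exists (h (white_at x)); last by rewrite -bv hx.
by apply: step => //; rewrite -hx -memS bv.
Qed.

Let black (u : K) := val (col (e (val u))) == 0.

Lemma rotations_triangulation : eulerian_triangulation f h t black.
Proof.
have ft u : val (f (t u)) = val (h u) by rewrite fE tE hE eK.
split.
- by move=> u; apply: val_inj; rewrite !hE nnn eK !nnn.
- by move=> u; apply: val_inj; rewrite ft.
- move=> u; apply: val_inj; rewrite !tE; set x := val u.
  have wx : ~~ white (e x).
    have := valP u; rewrite -/x -col_n => /eqP wx; apply/eqP => wnx.
    by have [_ _ _ []] := colours x; rewrite wx wnx.
  have [+ _] := hexagon wx; rewrite /= /face_perm eK => ->.
  by rewrite eK.
- move=> u; apply/eqP => /(congr1 val); rewrite tE; set x := val u => tx.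
  have wx : ~~ white (e x).
    have := valP u; rewrite -/x -col_n => /eqP wx; apply/eqP => wnx.
    by have [_ _ _ []] := colours x; rewrite wx wnx.
  have [_] := hexagon wx; rewrite /= /face_perm eK.
  have -> : n (e (n x)) = e x by rewrite -{2}tx eK.
  by rewrite !inE eqxx !orbT.
- move=> u; rewrite /black fE; set x := val u.
  have := valP u; rewrite -/x -(col_phi x) -(col_n (n (e x))) => /eqP.
  have := colours (e x).
  move: (val (col (e x))) (val (col (n (e x)))) (val (col (n (n (e x))))).
  by move=> [|[|[|a]]] [|[|[|b]]] [|[|[|d]]] [+ + + [+ + +]].
- move=> u; rewrite /black hE; set x := val u.
  have := valP u; rewrite -/x -!col_n nnn -col_n => /eqP.
  have := colours x; move: (val (col x)) (val (col (n x))) (val (col (n (n x)))).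
  by move=> [|[|[|a]]] [|[|[|b]]] [|[|[|d]]] [+ + + [+ + +]].
- exact: rotations_connected.
- exact: euler_rotations.
exact: rotations_four_connected.
Qed.

(** The three permitted values are the corners of the three neighbours of a vertex in G; [f^-1] is
    allowed because splitting a vertex of degree 4 reverses two of its steps. *)
Lemma single_cycle_hamiltonian (p : {perm K}) :
  (forall u, p u \in [set f u; f^-1%g u; h u]) -> single_cycle p -> hamiltonian n e.
Proof.
move=> pE cyc.
have K3 : 2 < #|{: K}|.
  exact: leq_trans (card_T_gt rotations_triangulation).
have /card_gt0P[u0 _] : 0 < #|{: K}| by apply: leq_trans K3.
pose vtx (u : K) := vertex_of n (val u).
have memv u x : (x \in vtx u) = (x \in porbit n (val u)) by rewrite inE fconnect_porbit.
have in_orbit u : u \in orbit p u0 by rewrite -fconnect_orbit fconnect_porbit cyc.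
have eq_vtx x u : x \in vtx u -> corner x = val u.
  by rewrite memv porbit_sym => /(corner_unique (valP u)).
exists [seq vtx u | u <- orbit p u0]; split.
- rewrite map_inj_uniq ?orbit_uniq // => u v uv; apply: val_inj.
  have : val u \in vtx v by rewrite -uv memv porbit_id.
  by move/eq_vtx <-; rewrite corner_white // (valP u).
- move=> A; apply/imsetP/mapP => [[x _ ->]|[u _ ->]]; last by exists (val u).
  exists (white_at x) => //; apply/setP=> y; rewrite memv inE fconnect_porbit /=.
  suff -> : porbit n x = porbit n (corner x) by [].
  by apply/eqP; rewrite eq_porbit_mem porbit_sym corner_porbit.
- rewrite size_map; apply: leq_trans K3 _; apply: leq_trans (card_size _).
  by apply: subset_leq_card; apply/subsetP=> u _; exact: in_orbit.
rewrite cycle_map; apply: sub_cycle (cycle_orbit (@perm_inj _ p) u0) => u v /eqP <- /=.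
have mem_n x i : iter i n x \in porbit n x by rewrite -permX mem_porbit.
have adj w : graph_adj e (vtx w) (vtx (f w)).
  apply/exists_inP; exists (val w); rewrite memv ?porbit_id //.
  by rewrite fE porbit_sym (mem_n _ 1).
have := pE u; rewrite !inE => /orP[/orP[]|] /eqP ->; first exact: adj.
  have /exists_inP[x xw ex] := adj (f^-1%g u); rewrite permKV in ex.
  by apply/exists_inP; exists (e x); rewrite ?eK.
apply/exists_inP; exists (n (val u)); rewrite memv; first exact: (mem_n _ 1).
by rewrite hE porbit_sym (mem_n _ 2).
Qed.

End Rotations.

Theorem hexagonal_hamiltonian : hamiltonian n e.
Proof.
have [f fE] : exists f : {perm K}, forall u, val (f u) = n (e (val u)).
  have wf x : white x -> white (phi x) by rewrite permM; exact: white_f.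
  have [f fE] := perm_subtype wf.
  by exists f => u; rewrite fE permM.
have [h hE] : exists h : {perm K}, forall u, val (h u) = n (n (e (n (val u)))).
  have wh x : white x -> white ((n * e * n * n)%g x) by rewrite !permM; exact: white_h.
  by have [h hE] := perm_subtype wh; exists h => u; rewrite hE !permM.
have [t tE] : exists t : {perm K}, forall u, val (t u) = e (n (e (n (val u)))).
  have wt x : white x -> white ((n * e * n * e)%g x) by rewrite !permM; exact: white_t.
  by have [t tE] := perm_subtype wt; exists t => u; rewrite tE !permM.
have tri := rotations_triangulation fE hE tE.
have [oddV|evenV] := boolP (odd #|porbits f|).
  by have [p pE cyc] := odd_order_single_cycle tri oddV; exact: (single_cycle_hamiltonian fE hE tE pE).
by have [p pE cyc] := even_order_single_cycle tri evenV; exact: (single_cycle_hamiltonian fE hE tE pE).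
Qed.

End PlaneGraph.

Theorem theorem2 (D : finType) (n e : {perm D}) (col : D -> 'I_3) :
  cubic_plane_graph n e ->
  bipartite_map n e ->
  proper_face_coloring n e col ->
  (forall x, val (col x) != 2 -> fingraph.order (face_perm n e) x = 6) ->
  k_connected (contracted_vertices n e col) (contracted_adj n e) 4 ->
  hamiltonian n e.
Proof. by move=> plane _; exact: hexagonal_hamiltonian. Qed.
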